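(* There is a finite subset $X\subseteq F_2$ of the free group $F_2$ of rank $2$ and a single automorphism $\phi\in\operatorname{Aut}(F_2)$ such that membership in the submonoid of $F_2$ generated by $\bigcup_{i\in\mathbb{Z}}\phi^i(X)$ is undecidable.
   Context: For a group $G$ generated by a finite set $B$ and a submonoid $M\leq G$, membership in $M$ is undecidable if there is no algorithm that takes an arbitrary word over $B\cup B^{-1}$ and decides whether the element of $G$ it represents belongs to $M$. *)

(* Defs.v *)
From HB Require Import structures.
From mathcomp Require Import all_boot all_order all_fingroup all_algebra.
Set Implicit Arguments. Unset Strict Implicit. Unset Printing Implicit Defensive.

Local Open Scope group_scope.

(* The letter (x, true) stands for the generator x, and (x, false) for x^-1. *)
Definition letter (T : Type) : Type := (T * bool)%type.

Definition linv (T : Type) (a : letter T) : letter T := (a.1, ~~ a.2).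

Section ReducedWords.
Variable T : choiceType.
Implicit Types (a b : letter T) (u v w : seq (T * bool)).

Definition reduced w : bool := sorted (fun a b => b != linv a) w.

Definition lpush a w : seq (T * bool) :=
  if w is b :: w' then if b == linv a then w' else a :: w else [:: a].

Definition wmul u v : seq (T * bool) := foldr lpush v u.

Definition winv w : seq (T * bool) := rev (map (@linv T) w).

Lemma linvK : involutive (@linv T).
Proof. by case=> x b; rewrite /linv /= negbK. Qed.

Lemma linv_neq a : linv a != a.
Proof. by case: a => x []; rewrite /linv /= -pair_eqE /= eqxx. Qed.

Lemma reduced_behead a w : reduced (a :: w) -> reduced w.
Proof. by rewrite /reduced /=; case: w => //= b w /andP[]. Qed.

Lemma lpush_reduced a w : reduced w -> reduced (lpush a w).
Proof.
case: w => //= b w Hw; case: ifP => [_|/negbT Hb]; first exact: reduced_behead Hw.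
by rewrite /reduced /= Hb.
Qed.

Lemma wmul_reduced u v : reduced v -> reduced (wmul u v).
Proof. by move=> Hv; elim: u => //= a u; exact: lpush_reduced. Qed.

Lemma lpushK a w : reduced w -> lpush (linv a) (lpush a w) = w.
Proof.
case: w => [_|b w Hw] /=; first by rewrite linvK eqxx.
case: ifP => [/eqP Hb|_] /=; last by rewrite linvK eqxx.
rewrite Hb in Hw *; case: w Hw => //= c w.
by rewrite /reduced /= => /andP[/negPf -> _].
Qed.

Lemma wmul_lpush a u v : reduced v -> wmul (lpush a u) v = lpush a (wmul u v).
Proof.
move=> Hv; case: u => //= b u; case: ifP => // /eqP ->.
by rewrite -[in RHS](linvK a) linvK -{1}(linvK a) lpushK ?wmul_reduced.
Qed.

Lemma wmulA u v w : reduced w -> wmul u (wmul v w) = wmul (wmul u v) w.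
Proof. by move=> Hw; elim: u => //= a u ->; rewrite wmul_lpush. Qed.

Lemma wmul1 w : reduced w -> wmul w [::] = w.
Proof.
elim: w => //= a w IH Hw; rewrite IH ?(reduced_behead Hw) //.
by case: w Hw {IH} => //= b w; rewrite /reduced /= => /andP[/negPf -> _].
Qed.

Lemma winvK : involutive winv.
Proof.
by move=> w; rewrite /winv map_rev revK -map_comp map_id_in // => a _ /=; rewrite linvK.
Qed.

Lemma winv_reduced w : reduced w -> reduced (winv w).
Proof.
rewrite /winv /reduced rev_sorted sorted_map; congr (is_true _).
by apply: eq_sorted => a b /=; rewrite linvK eq_sym -(inj_eq (can_inj linvK)) linvK.
Qed.

Lemma wmulVw w v : reduced v -> wmul (winv w) (wmul w v) = v.
Proof.
move=> Hv; elim: w => //= a w IH.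
rewrite /winv /= rev_cons /wmul foldr_rcons lpushK; last exact: wmul_reduced.
exact: IH.
Qed.

End ReducedWords.

Record free_group (T : choiceType) : Type :=
  FreeGroup { fgword :> seq (T * bool); _ : reduced fgword }.

HB.instance Definition _ (T : choiceType) := [isSub for @fgword T].
HB.instance Definition _ (T : choiceType) := [Choice of free_group T by <:].

Section FreeGroup.
Variable T : choiceType.
Implicit Types x y z : free_group T.

Lemma fgword_reduced x : reduced x.
Proof. by case: x. Qed.

Definition fg_one : free_group T := @FreeGroup T [::] isT.
Definition fg_mul x y : free_group T :=
  FreeGroup (wmul_reduced x (fgword_reduced y)).
Definition fg_inv x : free_group T :=
  FreeGroup (winv_reduced (fgword_reduced x)).

Lemma fg_mulA : associative fg_mul.
Proof. by move=> x y z; apply: val_inj; rewrite /= wmulA ?fgword_reduced. Qed.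

Lemma fg_mul1x : left_id fg_one fg_mul.
Proof. by move=> x; apply: val_inj. Qed.

Lemma fg_mulx1 : right_id fg_one fg_mul.
Proof. by move=> x; apply: val_inj; rewrite /= wmul1 ?fgword_reduced. Qed.

Lemma fg_mulVx : left_inverse fg_one fg_inv fg_mul.
Proof.
move=> x; apply: val_inj => /=.
by rewrite -{2}(wmul1 (fgword_reduced x)) wmulVw.
Qed.

Lemma fg_mulxV : right_inverse fg_one fg_inv fg_mul.
Proof.
move=> x; have := fg_mulVx (fg_inv x); congr (fg_mul _ _ = _).
by apply: val_inj; rewrite /= winvK.
Qed.

End FreeGroup.

HB.instance Definition _ (T : choiceType) :=
  isGroup.Build (free_group T) (@fg_mulA T) (@fg_mul1x T) (@fg_mulx1 T)
    (@fg_mulVx T) (@fg_mulxV T).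

Definition fgen (T : choiceType) (t : T) : free_group T :=
  @FreeGroup T [:: (t, true)] isT.

Definition eval_word (I : Type) (G : groupType) (b : I -> G) (w : seq (I * bool)) : G :=
  \prod_(a <- w) (if a.2 then b a.1 else (b a.1)^-1).

Section Universal.
Variable T : choiceType.

Lemma eval_fgen (x : free_group T) : eval_word (@fgen T) x = x.
Proof.
apply: val_inj; rewrite /= -[RHS]wmul1 ?fgword_reduced //.
elim: (fgword x) => [|[t s] w /= <-]; first by rewrite /eval_word big_nil.
by rewrite /eval_word big_cons; case: s.
Qed.

Variables (G : groupType) (b : T -> G).

Lemma eval_lpush a w : eval_word b (lpush a w) = eval_word b [:: a] * eval_word b w.
Proof.
have E c u : eval_word b (c :: u) = eval_word b [:: c] * eval_word b u.
  by rewrite /eval_word !big_cons big_nil mulg1.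
case: w => [|c w] /=; first by rewrite {3}/eval_word big_nil mulg1.
case: ifP => [/eqP ->|_]; last exact: E.
rewrite (E (linv a)) mulgA -[LHS]mul1g; congr (_ * _).
by rewrite /eval_word !big_cons !big_nil !mulg1; case: a => t [] /=; rewrite ?mulgV ?mulVg.
Qed.

Lemma free_lift : exists f : {multiplicative free_group T -> G}, forall t, f (fgen t) = b t.
Proof.
have fM : {morph (fun x : free_group T => eval_word b x) : x y / x * y}.
  move=> [u Hu] [v Hv] /=; elim: u {Hu} => /= [|a u IH].
    by rewrite {2}/eval_word big_nil mul1g.
  by rewrite eval_lpush IH mulgA /eval_word !big_cons big_nil mulg1.
pose m := isMultiplicative.Build _ _ _ fM.
pose f : {multiplicative free_group T -> G} :=
  HB.pack (fun x : free_group T => eval_word b x) m.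
by exists f => t; rewrite /= /eval_word /= big_cons big_nil mulg1.
Qed.

Lemma free_lift_uniq (f g : {multiplicative free_group T -> G}) :
  (forall t, f (fgen t) = g (fgen t)) -> f =1 g.
Proof.
have M1 (h : {multiplicative free_group T -> G}) : h 1 = 1.
  by apply: (@mulgI _ (h 1)); rewrite -gmulfM !mulg1.
have MV (h : {multiplicative free_group T -> G}) x : h x^-1 = (h x)^-1.
  by apply: (@mulgI _ (h x)); rewrite -gmulfM !mulgV M1.
move=> Efg x; rewrite -(eval_fgen x) /eval_word.
elim: (fgword x) => [|[t s] w IH]; first by rewrite big_nil !M1.
by rewrite big_cons !gmulfM IH /=; case: s; rewrite ?MV Efg.
Qed.

End Universal.

Record automorphism (G : groupType) : Type := Automorphism {
  aut_map :> {multiplicative G -> G};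
  aut_inv : G -> G;
  aut_mapK : cancel aut_map aut_inv;
  aut_invK : cancel aut_inv aut_map
}.

Definition aut_iter (G : groupType) (phi : automorphism G) (i : int) (x : G) : G :=
  match i with
  | Posz n => iter n phi x
  | Negz n => iter n.+1 (aut_inv phi) x
  end.

Inductive submonoid_gen (G : groupType) (S : G -> Prop) : G -> Prop :=
| submonoid_gen1 : submonoid_gen S 1
| submonoid_gen_mem x : S x -> submonoid_gen S x
| submonoid_genM x y : submonoid_gen S x -> submonoid_gen S y -> submonoid_gen S (x * y).

(* Deterministic single-tape Turing machines with input alphabet S; the tape is
   infinite in both directions. In tm_step, the boolean true means "move right". *)
Record turing_machine (S : finType) : Type := TuringMachine {
  tm_state : finType;
  tm_symbol : finType;
  tm_input : S -> tm_symbol;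
  tm_blank : tm_symbol;
  tm_start : tm_state;
  tm_accept : tm_state;
  tm_reject : tm_state;
  tm_step : tm_state -> tm_symbol -> tm_state * tm_symbol * bool;
  tm_input_inj : injective tm_input;
  tm_input_blank s : tm_input s != tm_blank;
  tm_accept_reject : tm_accept != tm_reject
}.

Section Runs.
Variables (S : finType) (D : turing_machine S).

(* (q, l, r): the head reads the first symbol of r; l lists the symbols to the
   left of the head, nearest first; cells beyond l and r are blank. *)
Definition tm_config : Type :=
  (tm_state D * seq (tm_symbol D) * seq (tm_symbol D))%type.

Definition tm_init (w : seq S) : tm_config :=
  (tm_start D, [::], map (@tm_input S D) w).

Definition tm_next (c : tm_config) : tm_config :=
  let: (q, l, r) := c in
  if (q == tm_accept D) || (q == tm_reject D) then c else
  let: (q', s, moves_right) := tm_step q (head (tm_blank D) r) in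
  if moves_right then (q', s :: l, behead r)
  else (q', behead l, head (tm_blank D) l :: s :: behead r).

Definition tm_reaches (w : seq S) (q : tm_state D) : Prop :=
  exists n : nat, (iter n tm_next (tm_init w)).1.1 = q.

Definition tm_decides (L : seq S -> Prop) : Prop :=
  forall w : seq S,
    (tm_reaches w (tm_accept D) \/ tm_reaches w (tm_reject D)) /\
    (tm_reaches w (tm_accept D) <-> L w).

End Runs.

Definition decidable_language (S : finType) (L : seq S -> Prop) : Prop :=
  exists D : turing_machine S, tm_decides D L.

(* I indexes, via b, a finite generating set B of G; the input is a word over
   B and its formal inverses. *)
Definition membership_undecidable (I : finType) (G : groupType) (b : I -> G)
    (M : G -> Prop) : Prop :=
  ~ decidable_language (fun w : seq (I * bool) => M (eval_word b w)).

(* Main.v *)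
From HB Require Import structures.
Require Import Defs.
From mathcomp Require Import all_boot all_order all_fingroup all_algebra.
From mathcomp Require Import zify.
From Stdlib Require Import ClassicalEpsilon FunctionalExtensionality.
Set Implicit Arguments. Unset Strict Implicit. Unset Printing Implicit Defensive.

(** The automorphism phi maps x to x and y to y x.  Put f = y^-1 x y,
    z = y x y^-1 and w = y^2 x y^-2.  Then phi^i fixes x and z, maps f to
    x^-i f x^i, and maps w to z^i w z^-i.  Write t for phi acting on F_2 in the
    semidirect product of F_2 and Z.  There z commutes with t, t with x t, and
    x t with f: this is the configuration in which two rational subsets can
    compare, term by term, the entries of a sequence of integers.

    States.  The conjugates token p 0 of w are used as locks: their images
    token p i under phi^i are again conjugates of w, with a conjugator that
    spells both p and i.  A generator s_p^-1 g phi^r(s_q), where s_p = token p 0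
    and g is a word in x, z, f, behaves as an edge from state p to state q:
    s_p^-1 g phi^r(s_q) and the phi^r-image of s_q^-1 g' phi^r'(s_u) compose to
    s_p^-1 g phi^r(g') phi^(r+r')(s_u), while tokens that do not match do not
    cancel.

    What the automaton does.  Given finitely many rules a k + b |-> c k + d on
    the natural numbers, a configuration has two integer coordinates nu and
    mu, and a word: the exponent of x is 3 nu, and the current token is token
    p i with i = 3 (nu - mu).  First, letters z at nu and f at mu are appended
    alternately; after each pair, (nu, mu) moves by (n, m) for some rule step
    n |-> m.  Then the word is erased from the right, and nu and mu may only
    move by equal amounts.  The word can be erased exactly when every step
    starts at the value at which the preceding one ended, so the target s_0^-1
    phi^(3N)(s_1) belongs to the submonoid if and only if the rules lead from
    N to 0.  One direction is a computation (reach_target).  For the other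
    (target_reach), F_2 acts on configurations extended by an integer weight,
    which counts with signs the tokens read at legal configurations; legality
    is preserved by the edges, so no element of the submonoid lowers the
    weight, and the target would lower it if its final configuration were not
    legal.

    Undecidability.  Counter programs become affine rules on Goedel numbers
    (machine_rulesP).  One fixed program treats N as the code of a Turing
    machine D, recomputes N, writes the word that spells the target for this
    very N on a simulated tape, and runs D on it until D rejects (simulatorP,
    simulates_reject).  Hence D rejects that word if and only if the word
    represents an element of the submonoid, and D does not decide membership. *)

(** * Integer powers and iterates of an automorphism *)

Section IntegerPowers.
Variable G : groupType.
Implicit Types (g h : G) (i j : int).
Local Open Scope group_scope.

Definition zpow g i : G :=
  match i with Posz n => g ^+ n | Negz n => g ^- n.+1 end.

Lemma zpowSr g i : zpow g (i + 1)%R = zpow g i * g.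
Proof.
case: i => [n|[|n]].
- have -> : (n%:Z + 1)%R = n.+1 by lia.
  by rewrite /zpow expgSr.
- by rewrite /= expg0 expg1 mulVg.
have -> : (Negz n.+1 + 1)%R = Negz n by lia.
by rewrite /= [g ^+ n.+2]expgS invgM mulgVK.
Qed.

Lemma zpowPr g i : zpow g (i - 1)%R = zpow g i * g^-1.
Proof. by rewrite -{2}[i](GRing.subrK 1%R) zpowSr mulgK. Qed.

Lemma zpowD g i j : zpow g (i + j)%R = zpow g i * zpow g j.
Proof.
elim: j => [|n IH|n IH]; first by rewrite GRing.addr0 /= mulg1.
- have -> : Posz n.+1 = (n%:Z + 1)%R by lia.
  by rewrite GRing.addrA !zpowSr IH mulgA.
have -> : (- n.+1%:Z)%R = (- n%:Z - 1)%R by lia.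
by rewrite GRing.addrA !zpowPr IH mulgA.
Qed.

Lemma zpowN g i : zpow g (- i)%R = (zpow g i)^-1.
Proof. by apply/esym/mulg1_eq; rewrite -zpowD GRing.subrr. Qed.

Lemma zpowJ g h i : zpow (g * h * g^-1) i = g * zpow h i * g^-1.
Proof.
have X n : (g * h * g^-1) ^+ n = g * h ^+ n * g^-1.
  by elim: n => [|n IH]; rewrite ?mulg1 ?mulgV // !expgS IH !mulgA mulgVK.
by case: i => n; rewrite /zpow X // !invgM invgK !mulgA.
Qed.

End IntegerPowers.

Section MorphGroup.
Variables (G H : groupType) (f : {multiplicative G -> H}).
Local Open Scope group_scope.

Lemma multiplicative1 : f 1 = 1.
Proof. by apply: (@mulgI _ (f 1)); rewrite -gmulfM !mulg1. Qed.

Lemma multiplicativeV x : f x^-1 = (f x)^-1.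
Proof. by apply/esym/mulg1_eq; rewrite -gmulfM mulgV multiplicative1. Qed.

Lemma multiplicativeX x n : f (x ^+ n) = f x ^+ n.
Proof.
by elim: n => [|n IH]; rewrite ?expg0 ?multiplicative1 // !expgS gmulfM IH.
Qed.

End MorphGroup.

Section AutIter.
Variables (G : groupType) (phi : automorphism G).
Local Open Scope group_scope.
Implicit Types (u v : G) (i j : int).

Let tw i u := aut_iter phi i u.

Lemma aut_inv_morph : {morph aut_inv phi : u v / u * v}.
Proof. exact: (can2_gmulfM (@aut_mapK _ phi) (@aut_invK _ phi)). Qed.

Lemma aut_iterM i : {morph tw i : u v / u * v}.
Proof.
move=> u v; case: i => n; rewrite /tw /aut_iter.
  by elim: n => //= n ->; rewrite gmulfM.
by elim: n.+1 => //= {}n ->; rewrite aut_inv_morph.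
Qed.

Lemma aut_iter1 i : tw i 1 = 1.
Proof. by apply: (@mulgI _ (tw i 1)); rewrite -aut_iterM !mulg1. Qed.

Lemma aut_iterV i u : tw i u^-1 = (tw i u)^-1.
Proof. by apply/esym/mulg1_eq; rewrite -aut_iterM mulgV aut_iter1. Qed.

Lemma aut_iterX i u n : tw i (u ^+ n) = tw i u ^+ n.
Proof. by elim: n => [|n IH]; rewrite ?aut_iter1 // !expgS aut_iterM IH. Qed.

Lemma aut_iter_zpow i u j : tw i (zpow u j) = zpow (tw i u) j.
Proof. by case: j => n; rewrite /= ?aut_iterV aut_iterX. Qed.

End AutIter.

(** * The automorphism and the words it moves by conjugation *)

Notation F2 := (free_group 'I_2).
Definition gx : F2 := fgen ord0.
Definition gy : F2 := fgen ord_max.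

(** The iterate phi^i fixes gz and moves gf: it is gf that lets an element of F_2
    remember i relative to the exponent of x, and gw relative to that of gz. *)
Definition gz : F2 := (gy * gx * gy^-1)%g.
Definition gf : F2 := (gy^-1 * gx * gy)%g.
Definition gw : F2 := (gy * gz * gy^-1)%g.

(** In the exponent of x, the labels of the automaton use multiples of 3 only.
    This leaves position 1 modulo 3 to spell the state p in powers of z, and
    position 2 to spell i.  The power z^i next to w is the one that phi^i
    produces, see twist_token. *)
Definition token_arm (p : nat) (i : int) : F2 := (gx * zpow gz p * gx * zpow gz i)%g.
Definition token p i : F2 := (token_arm p i * gw * (token_arm p i)^-1)%g.

Lemma twist_exists :
  exists phi : automorphism F2, phi gx = gx /\ phi gy = (gy * gx)%g.
Proof.
have [f fE] := free_lift (fun t : 'I_2 => if t == ord0 then gx else (gy * gx)%g).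
have [g gE] := free_lift (fun t : 'I_2 => if t == ord0 then gx else (gy * gx^-1)%g).
have [fx fy] : f gx = gx /\ f gy = (gy * gx)%g by rewrite !fE.
have [hx hy] : g gx = gx /\ g gy = (gy * gx^-1)%g by rewrite !gE.
have genP (t : 'I_2) : t = ord0 \/ t = ord_max.
  by case: t => [[|[|]]] // i; [left|right]; apply: val_inj.
have fK : cancel f g.
  have H : (g \o f : {multiplicative F2 -> F2}) =1 idfun.
    apply: free_lift_uniq => t; rewrite /=.
    case: (genP t) => ->; rewrite -/gx -/gy ?fx ?fy ?gmulfM ?hx ?hy //.
    by rewrite mulgVK.
  exact: H.
have gK : cancel g f.
  have H : (f \o g : {multiplicative F2 -> F2}) =1 idfun.
    apply: free_lift_uniq => t; rewrite /=.
    case: (genP t) => ->; rewrite -/gx -/gy ?hx ?hy ?gmulfM ?fx ?fy //.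
    by rewrite (multiplicativeV f) fx mulgK.
  exact: H.
by exists (Automorphism fK gK).
Qed.

Section Twist.
Variable phi : automorphism F2.
Hypotheses (phix : phi gx = gx) (phiy : phi gy = (gy * gx)%g).
Local Open Scope group_scope.
Implicit Types i j : int.

Lemma twist_x i : aut_iter phi i gx = gx.
Proof.
have Ix : aut_inv phi gx = gx by rewrite -{1}phix aut_mapK.
case: i => n; rewrite /aut_iter; first by elim: n => //= n ->.
by elim: n.+1 => //= {}n ->.
Qed.

(** The whole effect of phi^i is to insert x^i after each y (and x^-i before each
    y^-1); the formulas for the other words below follow by cancellation. *)
Lemma twist_y i : aut_iter phi i gy = gy * zpow gx i.
Proof.
have Ix : aut_inv phi gx = gx by rewrite -{1}phix aut_mapK.
have Iy : aut_inv phi gy = gy * gx^-1.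
  by rewrite -{1}[gy](mulgK gx) -phiy -{1}phix -(multiplicativeV phi) -gmulfM aut_mapK.
case: i => n; rewrite /aut_iter.
  elim: n => [|n IH]; first by rewrite /= mulg1.
  rewrite iterS IH gmulfM phiy -[zpow _ n]/(gx ^+ n) (multiplicativeX phi) phix -mulgA.
  by rewrite /= expgS.
have -> : zpow gx (Negz n) = gx^-1 ^+ n.+1 by rewrite /= expVgn.
have IV : aut_inv phi gx^-1 = gx^-1.
  by rewrite -{1}phix -(multiplicativeV phi) aut_mapK.
have IXn k : aut_inv phi (gx^-1 ^+ k) = gx^-1 ^+ k.
  elim: k => [|k IH]; last by rewrite expgS (aut_inv_morph phi) IH IV.
  by rewrite expg0 -{1}(multiplicative1 phi) aut_mapK.
elim: n.+1 => [|{}n IH]; first by rewrite /= mulg1.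
by rewrite iterS IH (aut_inv_morph phi) IXn Iy -mulgA -expgS.
Qed.

Lemma twist_z i : aut_iter phi i gz = gz.
Proof.
rewrite /gz !(aut_iterM phi) (aut_iterV phi) twist_x twist_y invgM !mulgA.
by rewrite -!(mulgA gy) -zpowSr -zpowN -zpowD GRing.addrC GRing.addKr.
Qed.

Lemma twist_f i : aut_iter phi i gf = zpow gx (- i) * gf * zpow gx i.
Proof.
by rewrite /gf !(aut_iterM phi) (aut_iterV phi) twist_x twist_y invgM zpowN !mulgA.
Qed.

Lemma twist_w i : aut_iter phi i gw = zpow gz i * gw * zpow gz (- i).
Proof.
rewrite /gw 2!(aut_iterM phi) twist_z (aut_iterV phi) twist_y invgM -zpowN !mulgA.
have E j : zpow gz j = gy * zpow gx j * gy^-1 by rewrite zpowJ.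
by rewrite !E !mulgA !mulgVK.
Qed.

Lemma twist_arm i p j : aut_iter phi i (token_arm p j) = token_arm p j.
Proof. by rewrite /token_arm 3!(aut_iterM phi) !(aut_iter_zpow phi) twist_z twist_x. Qed.

(** The conjugating arm is fixed by phi, so the iterates only add up next to w. *)
Lemma twist_token i p j : aut_iter phi i (token p j) = token p (i + j)%R.
Proof.
rewrite /token 2!(aut_iterM phi) (aut_iterV phi) twist_w twist_arm.
have -> : token_arm p (i + j)%R = token_arm p j * zpow gz i.
  by rewrite /token_arm GRing.addrC zpowD !mulgA.
by rewrite (invgM (token_arm p j)) zpowN !mulgA.
Qed.

End Twist.

(** * An action of the free group that records configurations *)

Notation vword := (free_group (int * bool)%type).

Section Monitor.
Variable U : int -> int -> int -> vword -> bool.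
Local Open Scope ring_scope.

(** The elements y^k x y^-k for k = -1, 0, 1, 2 are f, x, z, w.  Reading a word
    letter by letter thus needs the current y-height k, kept apart as an integer,
    and what these four words have done: rd_pos is the exponent of x; z is
    recorded in rd_word, rd_p or rd_i according to the residue of rd_pos modulo
    3, so that a legal word, a state and a twist do not get mixed up; f is
    recorded in rd_word; w changes rd_weight by 1 where the predicate U holds. *)
Record reading := Reading {
  rd_pos : int; rd_p : int; rd_i : int; rd_word : vword; rd_weight : int }.

Definition signum (b : bool) : int := if b then 1 else -1.
Definition vput (v : vword) c (b : bool) : vword :=
  (v * (if b then fgen c else (fgen c)^-1))%g.

Definition read_x (k : int) (b : bool) (h : reading) : reading :=
  let: Reading n p i v w := h in
  if k == 0 then Reading (n + signum b) p i v w
  else if k == -1 then Reading n p i (vput v (n, false) b) w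
  else if k == 2 then Reading n p i v (w + signum b * (U n p i v : nat)%:Z)
  else if k == 1 then
    if (n %% 3)%Z == 0 then Reading n p i (vput v (n, true) b) w
    else if (n %% 3)%Z == 1 then Reading n (p + signum b) i v w
    else Reading n p (i + signum b) v w
  else h.

Definition read (s : int * reading) (a : 'I_2 * bool) : int * reading :=
  if a.1 == ord0 then (s.1, read_x s.1 a.2 s.2) else (s.1 + signum a.2, s.2).

Lemma signumN b : signum (~~ b) = - signum b.
Proof. by case: b. Qed.

Lemma vputK v c b : vput (vput v c b) c (~~ b) = v.
Proof. by case: b; rewrite /vput /= ?mulgK ?mulgVK. Qed.

Lemma read_xK k b h : read_x k (~~ b) (read_x k b h) = h.
Proof.
have sgK a : a + signum b + signum (~~ b) = a by rewrite signumN GRing.addrK.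
have sgM a : signum b * a + signum (~~ b) * a = 0.
  by rewrite signumN GRing.mulNr GRing.subrr.
case: h => n p i v w; rewrite /read_x.
case: ifP => K0 /=; first by rewrite sgK.
case: ifP => K1 /=; first by rewrite vputK.
case: ifP => K2 /=; first by rewrite -GRing.addrA sgM GRing.addr0.
case: ifP => K3 //=.
case: ifP => H0; first by rewrite H0 vputK.
by case: ifP => H1; rewrite H0 H1 sgK.
Qed.

(** Reading is invertible: x at heights other than 0 records something but moves
    nothing that the record depends on. *)
Lemma readK s a : read (read s a) (linv a) = s.
Proof.
case: s a => k h [t b]; rewrite /read [(linv _).1]/= [(linv _).2]/=.
by case: (t == ord0); rewrite [_.1]/= [_.2]/= ?read_xK // signumN GRing.addrK.
Qed.

Definition walk (u : F2) s := foldl read s u.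

(** Free reduction does not change the outcome of reading. *)
Lemma foldl_lpush a w s : foldl read s (lpush a w) = foldl read (read s a) w.
Proof.
case: w => //= b w; case: ifP => // /eqP ->; by rewrite readK.
Qed.

Lemma walkM u v s : walk (u * v)%g s = walk v (walk u s).
Proof.
rewrite /walk /=; elim: (fgword u) s => //= a {}u IH s.
by rewrite foldl_lpush IH.
Qed.

Lemma walk1 s : walk 1%g s = s. Proof. by []. Qed.

Lemma walkV u s t : walk u s = t -> walk u^-1%g t = s.
Proof. by move=> <-; rewrite -walkM mulgV. Qed.

(** The family g is the orbit of a state under the powers of u. *)
Lemma walk_zpow u (g : int -> int * reading) : (forall i, walk u (g i) = g (i + 1)) ->
  forall j i, walk (zpow u j) (g i) = g (i + j).
Proof.
move=> H; elim => [|n IH|n IH] i.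
- by rewrite walk1 GRing.addr0.
- have -> : Posz n.+1 = (n%:Z + 1)%R by lia.
  by rewrite zpowSr walkM IH H GRing.addrA.
have -> : (- Posz n.+1 = - n%:Z - 1)%R by lia.
rewrite zpowPr walkM IH; apply: walkV; rewrite H; congr g; lia.
Qed.

Lemma walk_x h : walk gx (0, h) = (0, read_x 0 true h).
Proof. by []. Qed.

Lemma walk_z h : walk gz (0, h) = (0, read_x 1 true h).
Proof.
rewrite /gz !walkM; apply: walkV; by [].
Qed.

Lemma walk_f h : walk gf (0, h) = (0, read_x (-1) true h).
Proof.
rewrite /gf !walkM; have -> : walk gy^-1%g (0, h) = (-1, h) by apply: walkV.
by [].
Qed.

Lemma walk_w h : walk gw (0, h) = (0, read_x 2 true h).
Proof.
rewrite /gw /gz !walkM; apply: walkV => //; apply: walkV; by [].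
Qed.

End Monitor.

(** * Edges of an automaton as elements of the free group *)

(** inl (true, b) writes (b = true) or erases z at the first coordinate, inl (false, b)
    does so with f at the second coordinate, and inr (a, b) moves the coordinates
    by a and b.  A sum type comes with decidable equality. *)
Definition label : Type := (bool * bool + int * int)%type.

Definition label_elt (m : label) : F2 :=
  match m with
  | inl (true, b) => if b then gz else gz^-1%g
  | inl (false, b) => if b then gf else gf^-1%g
  | inr (a, _) => zpow gx (3 * a)%R
  end.

(** The coordinates of a configuration with twist i are nu and mu = nu - i / 3. *)
Definition label_twist (m : label) : int :=
  if m is inr (a, b) then (3 * (a - b))%R else 0.

Definition label_nu (m : label) (nu : int) : int :=
  if m is inr (a, _) then (nu + a)%R else nu.

Definition label_v (m : label) (i nu : int) (v : vword) : vword :=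
  match m with
  | inl (true, b) => vput v (3 * nu, true)%R b
  | inl (false, b) => vput v (3 * nu - i, false)%R b
  | inr _ => v
  end.

Definition transition : Type := (nat * label * nat)%type.

Definition transition_elt (t : transition) : F2 :=
  let: (p, m, q) := t in ((token p 0)^-1 * label_elt m * token q (label_twist m))%g.

Section Act.
Variable U : int -> int -> int -> vword -> bool.
Local Open Scope ring_scope.

Definition at_base nu v w : int * reading := (0, Reading (3 * nu) 0 0 v w).

(** Inside a token, w stands two positions to the right of the base point. *)
Definition weight (p : nat) (i nu : int) (v : vword) : int :=
  (U (3 * nu + 2) p i v : nat)%:Z.

(** The arm walks from position 0 to position 2 modulo 3 and spells p and i on its
    way; nothing is written in the word. *)
Lemma walk_arm p i nu v w :
  walk U (token_arm p i) (at_base nu v w) = (0, Reading (3 * nu + 2) p i v w).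
Proof.
have Ep a j : walk U (zpow gz a) (0, Reading (3 * nu + 1) j 0 v w)
    = (0, Reading (3 * nu + 1) (j + a) 0 v w).
  apply: (@walk_zpow U gz (fun n => (0, Reading (3 * nu + 1) n 0 v w))) => n.
  rewrite walk_z /read_x.
  have -> : ((3 * nu + 1) %% 3)%Z == 0 = false by lia.
  by have -> : ((3 * nu + 1) %% 3)%Z == 1 by lia.
have Ei a j : walk U (zpow gz a) (0, Reading (3 * nu + 2) p j v w)
    = (0, Reading (3 * nu + 2) p (j + a) v w).
  apply: (@walk_zpow U gz (fun n => (0, Reading (3 * nu + 2) p n v w))) => n.
  rewrite walk_z /read_x.
  have -> : ((3 * nu + 2) %% 3)%Z == 0 = false by lia.
  by have -> : ((3 * nu + 2) %% 3)%Z == 1 = false by lia.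
rewrite /token_arm !walkM walk_x [read_x _ _ _ _]/= Ep walk_x [read_x _ _ _ _]/=.
have -> : 3 * nu + signum true + signum true = 3 * nu + 2 by rewrite /signum; lia.
by rewrite Ei !GRing.add0r.
Qed.

Lemma walk_token p i nu v w :
  walk U (token p i) (at_base nu v w) = at_base nu v (w + weight p i nu v).
Proof.
rewrite /token 2!walkM walk_arm walk_w; apply: walkV; rewrite walk_arm.
by rewrite /read_x /= GRing.mul1r.
Qed.

Lemma walk_label (phi : automorphism F2) i m nu v w : phi gx = gx -> phi gy = (gy * gx)%g ->
  walk U (aut_iter phi i (label_elt m)) (at_base nu v w) =
  at_base (label_nu m nu) (label_v m i nu v) w.
Proof.
move=> phix phiy.
have Ax a n v' : walk U (zpow gx a) (0, Reading n 0 0 v' w) = (0, Reading (n + a) 0 0 v' w).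
  exact: (@walk_zpow U gx (fun n => (0, Reading n 0 0 v' w))).
have Az v' : walk U gz (at_base nu v' w) = at_base nu (vput v' (3 * nu, true) true) w.
  by rewrite walk_z /read_x /=; have -> : ((3 * nu) %% 3)%Z == 0 by lia.
have Af v' : walk U (zpow gx (- i) * gf * zpow gx i)%g (at_base nu v' w)
    = at_base nu (vput v' (3 * nu - i, false) true) w.
  by rewrite 2!walkM Ax walk_f /read_x /= Ax GRing.subrK.
case: m => [[[] []]|[a b]]; rewrite /= ?(aut_iterV phi) ?(twist_z phix phiy) ?(twist_f phix phiy).
- exact: Az.
- by apply: walkV; rewrite Az (vputK v _ false).
- exact: Af.
- by apply: walkV; rewrite Af (vputK v _ false).
rewrite (aut_iter_zpow phi) (twist_x phix) /at_base Ax; congr (_, Reading _ _ _ _ _); lia.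
Qed.

(** Whichever power of phi is applied to it, a generator trades the weight of a
    configuration at the current place for the weight of its successor along the
    edge.  So a set of configurations that is closed under the edges gives a
    weight that no generator lowers. *)
Lemma walk_transition (phi : automorphism F2) i p m q nu v w :
  phi gx = gx -> phi gy = (gy * gx)%g ->
  walk U (aut_iter phi i (transition_elt (p, m, q))) (at_base nu v w) =
  at_base (label_nu m nu) (label_v m i nu v)
    (w - weight p i nu v
     + weight q (i + label_twist m) (label_nu m nu) (label_v m i nu v)).
Proof.
move=> phix phiy; rewrite /transition_elt 2!(aut_iterM phi) (aut_iterV phi).
rewrite !(twist_token phix phiy) walkM [walk _ ((token p _)^-1 * _)%g _]walkM GRing.addr0.
have -> : walk U (token p i)^-1%g (at_base nu v w) = at_base nu v (w - weight p i nu v).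
  by apply: walkV; rewrite walk_token GRing.subrK.
by rewrite walk_label // walk_token.
Qed.

End Act.

(** * Affine rules as an automaton with a writing and an erasing phase *)

Definition rule : Type := (nat * nat * nat * nat)%type.

Definition affine_step (G : seq rule) (n m : nat) : Prop :=
  exists a b c d k, [/\ (a, b, c, d) \in G, n = a * k + b & m = c * k + d].

Inductive affine_reach (G : seq rule) (n : nat) : nat -> Prop :=
| affine_refl : affine_reach G n n
| affine_next m p : affine_reach G n m -> affine_step G m p -> affine_reach G n p.

Section Automaton.
Variable G : seq rule.
Local Open Scope ring_scope.

(** State 5 + r applies the rule r = (a, b, c, d): it is entered by a move by
    (b, d), and its loop adds (a, c) as often as wanted. *)
Definition rule_transitions (r : nat) : seq transition :=
  let: (a, b, c, d) := nth (0, 0, 0, 0)%N G r in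
  [:: (4, inr (Posz b, Posz d), 5 + r); (5 + r, inr (Posz a, Posz c), 5 + r);
      (5 + r, inr (Posz 0, Posz 0), 0)]%N.

(** State 0 is the writing state; the edges through 3 to 4 append z and f.
    State 1 is the erasing state; state 2 is entered by erasing f and left by
    erasing z, and its loop moves both coordinates by -1. *)
Definition transitions : seq transition :=
  [:: (0, inl (true, true), 3); (3, inl (false, true), 4); (0, inr (Posz 0, Posz 0), 1);
      (1, inl (false, false), 2); (2, inr (Negz 0, Negz 0), 2); (2, inl (true, false), 1)]%N
  ++ flatten [seq rule_transitions r | r <- iota 0 (size G)].

Lemma rule_transitions_sub r t : (r < size G)%N -> t \in rule_transitions r -> t \in transitions.
Proof.
move=> lt_r t_r; rewrite mem_cat; apply/orP; right.
by apply/flatten_mapP; exists r; rewrite // mem_iota.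
Qed.

(** What the writing phase can produce.  Nothing links consecutive steps yet. *)
Inductive pushed : int -> int -> seq (int * bool) -> Prop :=
| pushed0 : pushed 0 0 [::]
| pushedS nu mu l n m : pushed nu mu l -> affine_step G n m ->
    pushed (nu + n%:Z) (mu + m%:Z) (l ++ [:: (3 * nu, true); (3 * mu, false)]).

(** What the erasing phase can remove from given coordinates when it is to end
    at (0, - N): nu - mu never changes, and a round erases f at mu and
    then z at a position j below nu. *)
Inductive popped (N : nat) : int -> int -> seq (int * bool) -> Prop :=
| popped0 : popped N 0 (- N%:Z) [::]
| poppedS nu mu (j : nat) l : popped N (nu - j%:Z) (mu - j%:Z) l ->
    popped N nu mu (l ++ [:: (3 * (nu - j%:Z), true); (3 * mu, false)]).

Lemma poppedE N nu mu l : popped N nu mu l ->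
  [/\ l = [::], nu = 0 & mu = - N%:Z] \/
  exists2 j : nat, popped N (nu - j%:Z) (mu - j%:Z) (take (size l).-2 l) &
    l = take (size l).-2 l ++ [:: (3 * (nu - j%:Z), true); (3 * mu, false)].
Proof.
case=> [|{}nu {}mu j {}l Hl]; first by left.
by right; exists j; rewrite size_cat addn2 /= take_size_cat.
Qed.

(** Erasing keeps nu - mu, while the letters tell where nu and mu were before each
    step.  So, going backwards, each erased round forces the second entry of a
    step to be the first entry of the step after it.  The induction
    carries m, the value that the steps still to be erased have to produce. *)
Lemma pushed_popped N nu mu l : pushed nu mu l ->
  forall m : nat, popped N nu (mu - m%:Z) l -> affine_reach G N m.
Proof.
elim=> [|{}nu {}mu {}l n m _ IH step] k /poppedE [[E1 E2 E3]|[j]].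
- have -> : k = N by lia.
  exact: affine_refl.
- by move=> _ /(congr1 size); rewrite size_cat addn2.
- by move/(congr1 size): E1; rewrite size_cat addn2.
rewrite size_cat addn2 /= take_size_cat // => Hl /(congr1 (drop (size l))).
rewrite !drop_size_cat // => -[Ej Ek].
have {Ek} Ek : k = m by lia.
have {Ej} Ej : j = n by lia.
subst k j; apply: affine_next step; apply: IH.
by move: Hl; congr popped; lia.
Qed.

Definition positive (l : seq (int * bool)) : vword := (\prod_(c <- l) fgen c)%g.

Lemma positive_cat l1 l2 : positive (l1 ++ l2) = (positive l1 * positive l2)%g.
Proof. exact: big_cat. Qed.

Lemma positive_cons c l : positive (c :: l) = (fgen c * positive l)%g.
Proof. exact: big_cons. Qed.

Lemma positive_nil : positive [::] = 1%g.
Proof. exact: big_nil. Qed.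

(** A word without inverse letters is reduced, hence it is its own normal form. *)
Lemma positive_inj : injective positive.
Proof.
have E l : fgword (positive l) = [seq (c, true) | c <- l].
  elim: l => [|c l IH]; first by rewrite positive_nil.
  rewrite positive_cons /= IH; case: l {IH} => //= d l.
  by rewrite /linv /= xpair_eqE andbF.
move=> l1 l2 /(congr1 (@fgword _)); rewrite !E; apply: inj_map.
by move=> c1 c2 [].
Qed.

Variable N : nat.

(** The configurations met on the way to the target.  In the erasing states, u is
    the part already erased, (nu1, mu1) is the place where writing stopped, and the
    invariant says that any way to erase the rest extends to a way to erase the
    whole word from (nu1, mu1). *)
Definition legal_at (p : nat) (nu mu : int) (v : vword) : Prop :=
  match p with
  | 0%N => exists2 l, pushed nu mu l & v = positive l
  | 1%N => exists nu1 mu1 l u, [/\ pushed nu1 mu1 l, (v * positive u)%g = positive l &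
      forall w, popped N nu mu w -> popped N nu1 mu1 (w ++ u)]
  | 2%N => exists nu1 mu1 l u, [/\ pushed nu1 mu1 l, (v * positive u)%g = positive l &
      forall w (j : nat), popped N (nu - j%:Z) (mu - j%:Z) w ->
        popped N nu1 mu1 (w ++ (3 * (nu - j%:Z), true) :: u)]
  | 3%N => exists2 l, pushed nu mu l & v = positive (l ++ [:: (3 * nu, true)])
  | 4%N => exists2 l, pushed nu mu l &
      v = positive (l ++ [:: (3 * nu, true); (3 * mu, false)])
  | r.+4.+1 => let: (a, b, c, d) := nth (0, 0, 0, 0)%N G r in
    exists l nu0 mu0 (k : nat), [/\ (r < size G)%N, pushed nu0 mu0 l,
      v = positive (l ++ [:: (3 * nu0, true); (3 * mu0, false)]),
      nu = nu0 + (a * k + b)%N%:Z & mu = mu0 + (c * k + d)%N%:Z]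
  end.

Definition legal (p : nat) (i nu : int) (v : vword) : Prop :=
  exists2 mu, i = 3 * (nu - mu) & legal_at p nu mu v.

Lemma legal_transition p m q i nu v : (p, m, q) \in transitions -> legal p i nu v ->
  legal q (i + label_twist m) (label_nu m nu) (label_v m i nu v).
Proof.
rewrite mem_cat => /orP[|/flatten_mapP[r]]; last first.
  rewrite mem_iota add0n => /andP[_ lt_r]; rewrite /rule_transitions.
  case Er: (nth _ _ _) => [[[a b] c] d].
  have step k : affine_step G (a * k + b) (c * k + d).
    by exists a, b, c, d, k; split=> //; rewrite -Er mem_nth.
  rewrite !inE => /or3P[]/eqP[-> -> ->] [mu -> H]; rewrite /= in H *.
  - case: H => l Hl Hv; exists (mu + d%:Z); first by lia.
    rewrite /= Er; exists l, nu, mu, 0%N; split=> //; lia.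
  - rewrite Er in H; case: H => l [nu0 [mu0 [k [_ Hl Hv Hn Hm]]]].
    exists (mu + c%:Z); first by lia.
    rewrite /= Er; exists l, nu0, mu0, k.+1; split=> //; lia.
  rewrite Er in H; case: H => l [nu0 [mu0 [k [_ Hl Hv Hn Hm]]]].
  exists mu; first by lia.
  exists (l ++ [:: (3 * nu0, true); (3 * mu0, false)]) => //.
  by rewrite GRing.addr0 Hn Hm; apply: pushedS.
rewrite !inE => /or4P[|||/or3P[]] /eqP[-> -> ->] [mu -> H]; rewrite /= in H *.
- exists mu; first by lia.
  case: H => l Hl ->; exists l => //.
  by rewrite positive_cat positive_cons positive_nil mulg1.
- exists mu; first by lia.
  case: H => l Hl ->; exists l => //.
  have -> : 3 * nu - 3 * (nu - mu) = 3 * mu by lia.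
  by rewrite !positive_cat !positive_cons positive_nil !mulg1 /vput mulgA.
- exists mu; first by lia.
  case: H => l Hl Hv; rewrite GRing.addr0; exists nu, mu, l, [::]; split=> //.
    by rewrite Hv positive_nil mulg1.
  by move=> w; rewrite cats0.
- exists mu; first by lia.
  have -> : 3 * nu - 3 * (nu - mu) = 3 * mu by lia.
  case: H => nu1 [mu1 [l [u [Hl Hv Hw]]]].
  exists nu1, mu1, l, ((3 * mu, false) :: u); split=> //.
    by rewrite positive_cons mulgA /vput mulgVK.
  by move=> w j /poppedS/Hw; rewrite -catA.
- exists (mu - 1); first by lia.
  case: H => nu1 [mu1 [l [u [Hl Hv Hw]]]].
  exists nu1, mu1, l, u; split=> // w j Hp.
  have E : nu + Negz 0 - j%:Z = nu - j.+1%:Z by lia.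
  have E' : mu - 1 - j%:Z = mu - j.+1%:Z by lia.
  by rewrite E; apply: Hw; rewrite -E -E'.
exists mu; first by lia.
case: H => nu1 [mu1 [l [u [Hl Hv Hw]]]].
exists nu1, mu1, l, ((3 * nu, true) :: u); split=> //.
  by rewrite positive_cons mulgA /vput mulgVK.
by move=> w Hp; have := Hw w 0%N; rewrite !GRing.subr0; apply.
Qed.

Lemma legal_start : legal 0 0 0 1%g.
Proof.
exists 0 => //; exists [::]; first exact: pushed0.
by rewrite positive_nil.
Qed.

(** When the word is erased, u is everything that was written. *)
Lemma legal_target : legal 1 (3 * N%:Z) 0 1%g -> affine_reach G N 0.
Proof.
case=> mu E [nu1 [mu1 [l [u [Hl Hv Hw]]]]].
have {E} E : mu = - N%:Z by lia.
move: Hv; rewrite mul1g => /positive_inj E'; subst u mu.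
apply: pushed_popped Hl _ _; rewrite GRing.subr0.
exact: Hw (popped0 N).
Qed.
End Automaton.

(** * The target lies in the submonoid exactly when 0 is reachable *)

Section Submonoid.
Variables (G : seq rule) (phi : automorphism F2).
Hypotheses (phix : phi gx = gx) (phiy : phi gy = (gy * gx)%g).
Local Open Scope group_scope.

Definition rule_elts : seq F2 := [seq transition_elt t | t <- transitions G].

Definition rule_submonoid : F2 -> Prop :=
  submonoid_gen (fun y : F2 =>
    exists (i : int) (x : F2), x \in rule_elts /\ y = aut_iter phi i x).

Definition target (N : nat) : F2 := (token 0 0)^-1 * token 1 (3 * N%:Z)%R.

Section OnlyIf.
Variable N : nat.
Local Open Scope ring_scope.

Definition legal_mark (n p i : int) (v : vword) : bool :=
  if excluded_middle_informative
       (exists (q : nat) (nu : int), [/\ n = 3 * nu + 2, p = q & legal G N q i nu v])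
  then true else false.

Lemma legal_markP q i nu v :
  reflect (legal G N q i nu v) (legal_mark (3 * nu + 2) q i v).
Proof.
rewrite /legal_mark; case: excluded_middle_informative => H; constructor.
  case: H => q' [nu' [E [->] ]].
  by have -> : nu = nu' by lia.
by move=> L; apply: H; exists q, nu.
Qed.

Lemma weight_legal q i nu v :
  legal G N q i nu v -> weight legal_mark q i nu v = 1.
Proof. by move=> /legal_markP; rewrite /weight => ->. Qed.

Lemma weight_ge0 q i nu v : 0 <= weight legal_mark q i nu v.
Proof. by []. Qed.

(** Legal configurations are closed under the edges, hence weights never drop. *)
Lemma walk_submonoid y : rule_submonoid y -> forall nu v w, exists nu' v' w',
  walk legal_mark y (at_base nu v w) = at_base nu' v' w' /\ w <= w'.
Proof.
elim=> [|_ [i [_ [/mapP[[[p m] q] pmq ->] ->]]]|u1 u2 _ IH1 _ IH2] nu v w.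
- by exists nu, v, w.
- rewrite (walk_transition _ _ _ _ _ _ _ _ phix phiy); do 3!eexists; split; first by [].
  case: (excluded_middle_informative (legal G N p i nu v)) => L.
    by rewrite (weight_legal L) (weight_legal (legal_transition pmq L)); lia.
  have -> : weight legal_mark p i nu v = 0.
    by rewrite /weight; case: legal_markP.
  have := weight_ge0 q (i + label_twist m) (label_nu m nu) (label_v m i nu v); lia.
have [nu1 [v1 [w1 [E1 l1]]]] := IH1 nu v w.
have [nu2 [v2 [w2 [E2 l2]]]] := IH2 nu1 v1 w1.
by exists nu2, v2, w2; rewrite walkM E1 E2; split=> //; lia.
Qed.

(** The target reads the token of the legal start with sign -1, and then the token
    of its final configuration, which has to make up for the loss. *)
Lemma target_reach : rule_submonoid (target N) -> affine_reach G N 0.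
Proof.
move=> /walk_submonoid /(_ 0 1%g 0) [nu [v [w [E le_w]]]].
apply: legal_target; apply/legal_markP; move: E le_w.
rewrite /target walkM.
have -> : walk legal_mark (token 0 0)^-1%g (at_base 0 1%g 0) = at_base 0 1%g (- 1).
  by apply: walkV; rewrite walk_token (weight_legal (legal_start G N)).
by rewrite walk_token /weight => -[_ _ <-]; case: legal_mark.
Qed.

End OnlyIf.

Section If.
Variable N : nat.

(** The automaton can be in state p at (nu, mu) with h written so far. *)
Definition tracked (p : nat) (nu mu : int) (h : F2) : Prop :=
  rule_submonoid ((token 0 0)^-1 * h * zpow gx (3 * nu)%R * token p (3 * (nu - mu))%R).

Lemma tracked_transition p m q nu mu h : (p, m, q) \in transitions G -> tracked p nu mu h ->
  rule_submonoid ((token 0 0)^-1 * h * zpow gx (3 * nu)%R *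
    aut_iter phi (3 * (nu - mu))%R (label_elt m) *
    token q (3 * (nu - mu) + label_twist m)%R).
Proof.
move=> pmq Hp.
have Hm : rule_submonoid (aut_iter phi (3 * (nu - mu))%R (transition_elt (p, m, q))).
  apply: submonoid_gen_mem; exists (3 * (nu - mu))%R, (transition_elt (p, m, q)).
  by split=> //; apply: map_f.
move: (submonoid_genM Hp Hm); congr rule_submonoid.
rewrite /transition_elt 2!(aut_iterM phi) (aut_iterV phi) !(twist_token phix phiy) GRing.addr0.
move: (token 0 0) (token p _) (token q _) (aut_iter _ _ _) => a b c d.
by rewrite !mulgA mulgK.
Qed.

Definition zmark (nu : int) : F2 := zpow gx (3 * nu)%R * gz * zpow gx (- (3 * nu))%R.
Definition fmark (mu : int) : F2 := zpow gx (3 * mu)%R * gf * zpow gx (- (3 * mu))%R.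

Lemma tracked_shift p q (a b : int) nu mu h :
  (p, inr (a, b), q) \in transitions G -> tracked p nu mu h ->
  tracked q (nu + a)%R (mu + b)%R h.
Proof.
move=> pmq /(tracked_transition pmq); congr rule_submonoid; rewrite /=.
rewrite (aut_iter_zpow phi) (twist_x phix) -(mulgA _ (zpow gx _) (zpow gx _)) -zpowD.
congr (_ * zpow _ _ * token _ _); lia.
Qed.

Lemma tracked_z p q nu mu h : (p, inl (true, true), q) \in transitions G ->
  tracked p nu mu h -> tracked q nu mu (h * zmark nu).
Proof.
move=> pmq /(tracked_transition pmq); congr rule_submonoid; rewrite /= GRing.addr0.
by rewrite (twist_z phix phiy) /zmark zpowN !mulgA mulgVK.
Qed.

Lemma tracked_f p q nu mu h : (p, inl (false, true), q) \in transitions G ->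
  tracked p nu mu h -> tracked q nu mu (h * fmark mu).
Proof.
move=> pmq /(tracked_transition pmq); congr rule_submonoid; rewrite /= GRing.addr0.
congr (_ * _).
rewrite (twist_f phix phiy) /fmark; move: (token 0 0) gf => a f.
have -> : (3 * nu = 3 * mu + 3 * (nu - mu))%R by lia.
rewrite !zpowN zpowD; move: (zpow gx (3 * mu)%R) (zpow gx (3 * (nu - mu))%R) => b c.
by rewrite !mulgA !(mulgK, mulgVK).
Qed.

Lemma tracked_zV p q nu mu h : (p, inl (true, false), q) \in transitions G ->
  tracked p nu mu (h * zmark nu) -> tracked q nu mu h.
Proof.
move=> pmq /(tracked_transition pmq); congr rule_submonoid; rewrite /= GRing.addr0.
congr (_ * _); rewrite (aut_iterV phi) (twist_z phix phiy) /zmark zpowN.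
by move: (token 0 0) gz => a z; rewrite !mulgA mulgVK mulgK.
Qed.

Lemma tracked_fV p q nu mu h : (p, inl (false, false), q) \in transitions G ->
  tracked p nu mu (h * fmark mu) -> tracked q nu mu h.
Proof.
move=> pmq /(tracked_transition pmq); congr rule_submonoid; rewrite /= GRing.addr0.
congr (_ * _).
rewrite (aut_iterV phi) (twist_f phix phiy) /fmark; move: (token 0 0) gf => a f.
have -> : (3 * nu = 3 * mu + 3 * (nu - mu))%R by lia.
rewrite !zpowN zpowD; move: (zpow gx (3 * mu)%R) (zpow gx (3 * (nu - mu))%R) => b c.
by rewrite !invgM invgK !mulgA !(mulgK, mulgVK).
Qed.

Lemma tracked_eq p nu mu nu' mu' h :
  tracked p nu mu h -> nu = nu' -> mu = mu' -> tracked p nu' mu' h.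
Proof. by move=> H <- <-. Qed.

Lemma tracked_shiftn p (a b : int) nu mu h k :
  (p, inr (a, b), p) \in transitions G -> tracked p nu mu h ->
  tracked p (nu + a * k%:Z)%R (mu + b * k%:Z)%R h.
Proof.
move=> pmp H; elim: k => [|k IH]; first by rewrite !GRing.mulr0 !GRing.addr0.
apply: tracked_eq (tracked_shift pmp IH) _ _; lia.
Qed.

(** Writing and erasing are built together, from the outside in: for rules leading
    from N to m there is a way to write up to this point, and the word written can
    be erased once erasing comes back to this point with the second coordinate
    smaller by m.  For m = 0 the two halves meet. *)
Lemma reach_tracked m : affine_reach G N m -> exists nu mu h,
  tracked 0 nu mu h /\ (tracked 1 nu (mu - m%:Z)%R h -> rule_submonoid (target N)).
Proof.
elim=> [|n k _ [nu [mu [h [H0 H1]]]] [a [b [c [d [j [inG En Ek]]]]]]].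
  exists 0%R, 0%R, 1; split.
    rewrite /tracked !GRing.mulr0 !mulg1.
    by rewrite mulVg; apply: submonoid_gen1.
  rewrite /tracked /target !GRing.mulr0 !mulg1.
  by congr (rule_submonoid (_ * token _ _)); lia.
(* Writing: z, f, then one pass through the state of the rule. *)
have [r lt_r Er] := nthP (0, 0, 0, 0)%N inG.
have tr t : t \in rule_transitions G r -> t \in transitions G by apply: rule_transitions_sub.
have ruleE : rule_transitions G r = [:: (4, inr (Posz b, Posz d), 5 + r);
    (5 + r, inr (Posz a, Posz c), 5 + r); (5 + r, inr (Posz 0, Posz 0), 0)]%N.
  by rewrite /rule_transitions Er.
exists (nu + n%:Z)%R, (mu + k%:Z)%R, (h * zmark nu * fmark mu); split.
  have H3 : tracked 3 nu mu (h * zmark nu) by apply: tracked_z H0.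
  have H4 : tracked 4 nu mu (h * zmark nu * fmark mu) by apply: tracked_f H3.
  have H5 : tracked (5 + r) (nu + b%:Z)%R (mu + d%:Z)%R (h * zmark nu * fmark mu).
    by apply: tracked_shift H4; apply: tr; rewrite ruleE !inE eqxx.
  have H6 := @tracked_shiftn _ a%:Z c%:Z _ _ _ j (tr _ _) H5.
  have {}H6 := H6 ltac:(by rewrite ruleE !inE eqxx orbT).
  have : tracked 0 (nu + b%:Z + a%:Z * j%:Z + 0)%R (mu + d%:Z + c%:Z * j%:Z + 0)%R
      (h * zmark nu * fmark mu).
    by apply: tracked_shift H6; apply: tr; rewrite ruleE !inE eqxx !orbT.
  by move/tracked_eq; apply; lia.
(* Erasing: f at mu, a common move by - n, then z at nu. *)
rewrite GRing.addrK => K1; apply: H1.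
have K2 : tracked 2 (nu + n%:Z)%R mu (h * zmark nu) by apply: tracked_fV K1.
have K3 : tracked 2 (nu + n%:Z + Negz 0 * n%:Z)%R (mu + Negz 0 * n%:Z)%R (h * zmark nu).
  by apply: tracked_shiftn K2.
have {}K3 : tracked 2 nu (mu - n%:Z)%R (h * zmark nu) by apply: tracked_eq K3 _ _; lia.
by apply: tracked_zV K3.
Qed.

Lemma reach_target : affine_reach G N 0 -> rule_submonoid (target N).
Proof.
move=> /reach_tracked [nu [mu [h [H0 H1]]]]; apply: H1; rewrite GRing.subr0.
have : tracked 1 (nu + 0)%R (mu + 0)%R h by apply: tracked_shift H0.
by rewrite !GRing.addr0.
Qed.

End If.
End Submonoid.

(** * Spelling the target *)

Section TargetWord.
Local Open Scope group_scope.

Definition lx b : 'I_2 * bool := (ord0, b).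
Definition ly b : 'I_2 * bool := (ord_max, b).

(** Up to cancellation, the target is word_pre x^(3N) word_mid x^(-3N) word_post:
    the exponent of the last token of the target is the only place where N occurs,
    and z^i = y x^i y^-1. *)
Definition word_pre : seq ('I_2 * bool) :=
  [:: lx true; lx true; ly true; ly true; lx false; ly false; ly false;
      lx false; lx false; lx true; ly true; lx true; ly false; lx true; ly true].
Definition word_mid : seq ('I_2 * bool) :=
  [:: ly false; ly true; ly true; lx true; ly false; ly false; ly true].
Definition word_post : seq ('I_2 * bool) :=
  [:: ly false; lx false; ly true; lx false; ly false; lx false].

Definition target_word (N : nat) : seq ('I_2 * bool) :=
  word_pre ++ nseq (3 * N) (lx true) ++ word_mid ++ nseq (3 * N) (lx false)
    ++ word_post.

Lemma eval_cat (u v : seq ('I_2 * bool)) :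
  eval_word (@fgen 'I_2) (u ++ v)
  = eval_word (@fgen 'I_2) u * eval_word (@fgen 'I_2) v.
Proof. exact: big_cat. Qed.

Lemma eval_nseq n a : eval_word (@fgen 'I_2) (nseq n a)
  = (if a.2 then fgen a.1 else (fgen a.1)^-1) ^+ n.
Proof.
elim: n => [|n IH]; first by rewrite /eval_word big_nil.
by rewrite expgS -IH /eval_word big_cons.
Qed.

Lemma eval_target_word N : eval_word (@fgen 'I_2) (target_word N) = target N.
Proof.
rewrite /target_word !eval_cat !eval_nseq /eval_word !big_cons !big_nil /=.
rewrite -/gx -/gy !mulg1 /target /token /token_arm.
have -> : (3 * N%:Z)%R = Posz (3 * N) by lia.
have zE n : zpow gz (Posz n) = gy * gx ^+ n * gy^-1 by rewrite zpowJ.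
rewrite !zE /gw /gz expVgn expg0 expg1 !mulg1 mulgV !mulg1.
move: gx gy (gx ^+ _) => x y c.
by rewrite !invgM !invgK !mulgA !(mulgK, mulgVK).
Qed.

End TargetWord.

(** * Counter programs and their flow graphs *)

Definition upd (v : nat -> nat) (r n : nat) : nat -> nat :=
  fun i => if i == r then n else v i.

Inductive prog : Type :=
| Skip
| Inc of nat
| Seq of prog & prog
| Loop of nat & prog
| If of nat & prog & prog.

Inductive exec : prog -> (nat -> nat) -> (nat -> nat) -> Prop :=
| exec_skip v : exec Skip v v
| exec_inc r v : exec (Inc r) v (upd v r (v r).+1)
| exec_seq a b v v1 v2 : exec a v v1 -> exec b v1 v2 -> exec (Seq a b) v v2
| exec_loop0 r a v : v r = 0 -> exec (Loop r a) v v
| exec_loopS r a n v v1 v2 : v r = n.+1 -> exec a (upd v r n) v1 ->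
    exec (Loop r a) v1 v2 -> exec (Loop r a) v v2
| exec_ifS r a b n v w : v r = n.+1 -> exec a (upd v r n) w -> exec (If r a b) v w
| exec_if0 r a b v w : v r = 0 -> exec b v w -> exec (If r a b) v w.

Lemma exec_det p v w1 w2 : exec p v w1 -> exec p v w2 -> w1 = w2.
Proof.
move=> H; elim: H w2 => {p v w1}.
- by move=> v w2 H; inversion H.
- by move=> r v w2 H; inversion H.
- move=> a b v v1 v2 _ IHa _ IHb w2 H; inversion H; subst.
  by apply: IHb; rewrite (IHa _ H2).
- move=> r a v v0 w2 H.
  by inversion H as [| | | |? ? ? ? ? ? vn| |]; subst=> //; rewrite v0 in vn.
- move=> r a n v v1 v2 vn _ IHa _ IHb w2 H.
  inversion H as [| | |? ? ? v0|? ? m ? v3 ? vm Ha Hl| |]; subst.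
    by rewrite vn in v0.
  have Em : m = n by lia.
  by subst m; apply: IHb; rewrite (IHa _ Ha).
- move=> r a b n v w vn _ IHa w2 H.
  inversion H as [| | | | |? ? ? m ? ? vm Ha|? ? ? ? ? v0]; subst.
    have Em : m = n by lia.
    by subst m; apply: IHa.
  by rewrite vn in v0.
move=> r a b v w v0 _ IHb w2 H.
inversion H as [| | | | |? ? ? m ? ? vm Ha|]; subst; last exact: IHb.
by rewrite v0 in vm.
Qed.

Variant op : Type := Nop | Incr of nat | Decr of nat | Test of nat.

Definition op_code (o : op) : nat * nat :=
  match o with Nop => (0, 0) | Incr r => (1, r) | Decr r => (2, r) | Test r => (3, r) end.
Definition op_decode (c : nat * nat) : op :=
  match c with (0, _) => Nop | (1, r) => Incr r | (2, r) => Decr r | (_, r) => Test r end.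
Lemma op_codeK : cancel op_code op_decode. Proof. by case. Qed.
HB.instance Definition _ := Equality.copy op (can_type op_codeK).

Definition op_sem (o : op) (v w : nat -> nat) : Prop :=
  match o with
  | Nop => w = v
  | Incr r => w = upd v r (v r).+1
  | Decr r => exists2 n, v r = n.+1 & w = upd v r n
  | Test r => v r = 0 /\ w = v
  end.

Definition edge : Type := (nat * op * nat)%type.

Inductive flow (E : seq edge) : nat -> nat * (nat -> nat) -> nat * (nat -> nat) -> Prop :=
| flow0 s : flow E 0 s s
| flowS k p o q v w t : (p, o, q) \in E -> op_sem o v w -> flow E k (q, w) t ->
    flow E k.+1 (p, v) t.

Lemma flow_trans E k1 k2 s1 s2 s3 :
  flow E k1 s1 s2 -> flow E k2 s2 s3 -> flow E (k1 + k2) s1 s3.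
Proof.
by elim=> // {}k1 p o q v w t pq vw _ IH /IH; rewrite addSn; apply: flowS pq vw.
Qed.

Fixpoint labels (c : prog) : nat :=
  match c with
  | Skip | Inc _ => 0
  | Seq a b => (labels a + labels b).+1
  | Loop _ a => (labels a).+1
  | If _ a b => (labels a + labels b).+2
  end.

(** The edges run from label p to label q; the labels from n on are free. *)
Fixpoint compile (c : prog) (p q n : nat) : seq edge :=
  match c with
  | Skip => [:: (p, Nop, q)]
  | Inc r => [:: (p, Incr r, q)]
  | Seq a b => compile a p n n.+1 ++ compile b n q (n.+1 + labels a)
  | Loop r a => [:: (p, Test r, q); (p, Decr r, n)] ++ compile a n p n.+1
  | If r a b => [:: (p, Decr r, n); (p, Test r, n.+1)] ++
      compile a n q n.+2 ++ compile b n.+1 q (n.+2 + labels a)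
  end.

Definition exits (E : seq edge) (p : nat) (es : seq (op * nat)) : Prop :=
  forall o s, ((p, o, s) \in E) = ((o, s) \in es).

(** Only the edges that leave the labels of c are prescribed, so E can be the graph
    of a larger program. *)
Fixpoint fragment (E : seq edge) (c : prog) (p q : nat) : Prop :=
  match c with
  | Skip => exits E p [:: (Nop, q)]
  | Inc r => exits E p [:: (Incr r, q)]
  | Seq a b => exists2 m, fragment E a p m & fragment E b m q
  | Loop r a => exists2 m, exits E p [:: (Test r, q); (Decr r, m)] & fragment E a m p
  | If r a b => exists m1 m2, [/\ exits E p [:: (Decr r, m1); (Test r, m2)],
      fragment E a m1 q & fragment E b m2 q]
  end.

Lemma compile_source c p q n s o t : (s, o, t) \in compile c p q n ->
  s = p \/ n <= s < n + labels c.
Proof.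
elim: c p q n => [|r|a IHa b IHb|r a IHa|r a IHa b IHb] p q n /=.
- by rewrite !inE => /eqP[-> _ _]; left.
- by rewrite !inE => /eqP[-> _ _]; left.
- by rewrite mem_cat => /orP[/IHa|/IHb] []; lia.
- by rewrite !inE => /or3P[/eqP[-> _ _]|/eqP[-> _ _]|/IHa[]]; lia.
rewrite !inE mem_cat => /or4P[/eqP[-> _ _]|/eqP[-> _ _]|/IHa[]|/IHb[]]; lia.
Qed.

Lemma compile_fragment E c p q n : p < n ->
  (forall s o t, s = p \/ n <= s < n + labels c ->
    ((s, o, t) \in E) = ((s, o, t) \in compile c p q n)) ->
  fragment E c p q.
Proof.
have notin c' p' q' n' s o t : s <> p' -> ~ n' <= s < n' + labels c' ->
    ((s, o, t) \in compile c' p' q' n') = false.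
  by move=> H1 H2; apply/negP => /compile_source [].
elim: c p q n => [|r|a IHa b IHb|r a IHa|r a IHa b IHb] p q n lt_pn /= HE.
- by move=> o s; rewrite HE; [rewrite !inE !xpair_eqE eqxx | left].
- by move=> o s; rewrite HE; [rewrite !inE !xpair_eqE eqxx | left].
- exists n.
    apply: (IHa _ _ n.+1); first by lia.
    move=> s o t Hs; rewrite HE; last by lia.
    by rewrite mem_cat [X in _ || X]notin ?orbF //; lia.
  apply: (IHb _ _ (n.+1 + labels a)); first by lia.
  move=> s o t Hs; rewrite HE; last by lia.
  by rewrite mem_cat [X in X || _]notin //; lia.
- exists n.
    move=> o s; rewrite HE; last by left.
    by rewrite !inE !xpair_eqE eqxx /= notin ?orbF //; lia.
  apply: (IHa _ _ n.+1); first by lia.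
  move=> s o t Hs; rewrite HE; last by lia.
  have /negPf ne : s != p by lia.
  by rewrite !inE !xpair_eqE ne.
exists n, n.+1; split.
- move=> o s; rewrite HE; last by left.
  by rewrite !inE mem_cat !xpair_eqE eqxx /= !notin ?orbF //; lia.
- apply: (IHa _ _ n.+2); first by lia.
  move=> s o t Hs; rewrite HE; last by lia.
  have /negPf ne : s != p by lia.
  by rewrite !inE mem_cat !xpair_eqE ne /= [X in _ || X]notin ?orbF //; lia.
apply: (IHb _ _ (n.+2 + labels a)); first by lia.
move=> s o t Hs; rewrite HE; last by lia.
have /negPf ne : s != p by lia.
by rewrite !inE mem_cat !xpair_eqE ne /= [X in X || _]notin //; lia.
Qed.

Lemma exec_flow E c p q v w : fragment E c p q -> exec c v w ->
  exists k, flow E k (p, v) (q, w).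
Proof.
move=> Hf H; elim: H p q Hf => {c v w} /=.
- move=> v p q HE; exists 1.
  by apply: (@flowS _ _ _ Nop) (flow0 _ _); rewrite ?HE ?inE ?eqxx.
- move=> r v p q HE; exists 1.
  by apply: (@flowS _ _ _ (Incr r)) (flow0 _ _); rewrite ?HE ?inE ?eqxx.
- move=> a b v v1 v2 _ IHa _ IHb p q [m /IHa[k1 H1] /IHb[k2 H2]].
  by exists (k1 + k2); apply: flow_trans H1 H2.
- move=> r a v v0 p q [m HE _]; exists 1.
  by apply: (@flowS _ _ _ (Test r)) (flow0 _ _); rewrite ?HE ?inE ?eqxx.
- move=> r a n v v1 v2 vn _ IHa _ IHb p q [m HE Ha].
  have [k1 H1] := IHa _ _ Ha; have [k2 H2] : exists k, flow E k (p, v1) (q, v2).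
    by apply: IHb; exists m.
  exists (k1 + k2).+1; apply: (@flowS _ _ _ (Decr r)) (flow_trans H1 H2).
    by rewrite HE !inE eqxx orbT.
  by exists n.
- move=> r a b n v w vn _ IHa p q [m1 [m2 [HE /IHa[k Hk] _]]].
  exists k.+1; apply: (@flowS _ _ _ (Decr r)) Hk; first by rewrite HE !inE eqxx.
  by exists n.
move=> r a b v w v0 _ IHb p q [m1 [m2 [HE _ /IHb[k Hk]]]].
exists k.+1; apply: (@flowS _ _ _ (Test r)) Hk; first by rewrite HE !inE eqxx orbT.
by [].
Qed.

(** A path that ends in a label without outgoing edges has to leave each fragment
    through its exit; for a loop this is iterated along the path, whose length
    decreases. *)
Lemma flow_exec E e w : (forall o t, (e, o, t) \notin E) ->
  forall c p q k v, fragment E c p q -> flow E k (p, v) (e, w) ->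
  exists v' k', [/\ exec c v v', k' < k & flow E k' (q, v') (e, w)].
Proof.
move=> He.
have first_step p es k v : exits E p es -> es <> [::] -> flow E k (p, v) (e, w) ->
    exists o s v' k', [/\ (o, s) \in es, op_sem o v v', k = k'.+1 &
      flow E k' (s, v') (e, w)].
  move=> HE es0 H; inversion H as [|k' ? o s ? v' ? Hin Hsem Hk]; subst.
    by case: es HE es0 => // -[o s] es /(_ o s); rewrite inE eqxx (negPf (He _ _)).
  by rewrite HE in Hin; exists o, s, v', k'.
elim=> [|r|a IHa b IHb|r a IHa|r a IHa b IHb] p q k v /=.
- move=> HE /(first_step _ _ _ _ HE) [//|o [s [v' [k' [+ ov -> Hk]]]]].
  rewrite inE => /eqP[Eo Es]; subst; rewrite /= in ov; subst v'.
  by exists v, k'; split=> //; apply: exec_skip.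
- move=> HE /(first_step _ _ _ _ HE) [//|o [s [v' [k' [+ ov -> Hk]]]]].
  rewrite inE => /eqP[Eo Es]; subst; rewrite /= in ov; subst v'.
  by exists (upd v r (v r).+1), k'; split=> //; apply: exec_inc.
- move=> [m Ha Hb] /(IHa _ _ _ _ Ha) [v1 [k1 [E1 l1 /(IHb _ _ _ _ Hb)]]].
  move=> [v2 [k2 [E2 l2 H2]]]; exists v2, k2; split=> //; last by lia.
  exact: exec_seq E1 E2.
- move=> [m HE Ha]; elim/ltn_ind: k v => k IH v.
  move=> /(first_step _ _ _ _ HE) [//|o [s [v' [k' [+ ov Ek Hk]]]]].
  rewrite !inE => /orP[] /eqP[Eo Es]; subst.
    by case: ov => v0 ->{v'} in Hk *; exists v, k'; split=> //; apply: exec_loop0.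
  case: ov => n vn E'; subst v'.
  have [v1 [k1 [E1 l1 H1]]] := IHa _ _ _ _ Ha Hk.
  have [//|v2 [k2 [E2 l2 H2]]] := IH k1 _ v1 H1; first by lia.
  by exists v2, k2; split=> //; [apply: exec_loopS vn E1 E2 | lia].
move=> [m1 [m2 [HE Ha Hb]]].
move=> /(first_step _ _ _ _ HE) [//|o [s [v' [k' [+ ov Ek Hk]]]]].
rewrite !inE => /orP[] /eqP[Eo Es]; subst.
  case: ov => n vn E'; subst v'.
  have [v1 [k1 [E1 l1 H1]]] := IHa _ _ _ _ Ha Hk.
  by exists v1, k1; split=> //; [apply: exec_ifS vn E1 | lia].
case: ov => v0 E'; subst v'.
have [v1 [k1 [E1 l1 H1]]] := IHb _ _ _ _ Hb Hk.
by exists v1, k1; split=> //; [apply: exec_if0 v0 E1 | lia].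
Qed.

Lemma halts_flow c v :
  (exists w, exec c v w) <-> exists k w, flow (compile c 1 0 2) k (1, v) (0, w).
Proof.
have Hf : fragment (compile c 1 0 2) c 1 0 by apply: (@compile_fragment _ _ _ _ 2).
split=> [[w /(exec_flow Hf)[k Hk]]|[k [w Hk]]]; first by exists k, w.
have [|v' [_ [Hv _ _]]] := flow_exec _ Hf Hk; last by exists v'.
by move=> o t; apply/negP => /compile_source; lia.
Qed.

(** * Counter programs as affine rules on Goedel numbers *)

Definition reg_count : nat := 11.
Definition reg_prime (r : nat) : nat := nth 2 [:: 2; 3; 5; 7; 11; 13; 17; 19; 23; 29; 31] r.
Definition encode (v : nat -> nat) : nat := \prod_(r < reg_count) reg_prime r ^ v r.

Lemma reg_prime_gt1 r : 1 < reg_prime r.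
Proof. by rewrite /reg_prime; do 12?[case: r => [|r] //=]. Qed.

Lemma reg_prime_coprime r1 r2 : r1 < reg_count -> r2 < reg_count -> r1 != r2 ->
  coprime (reg_prime r1) (reg_prime r2).
Proof.
have H : all (fun i => all (fun j => (i != j) ==> coprime (reg_prime i) (reg_prime j))
   (iota 0 reg_count)) (iota 0 reg_count) by [].
move=> lt1 lt2; have /allP/(_ r1) := H; rewrite mem_iota => /(_ lt1).
by move/allP/(_ r2); rewrite mem_iota => /(_ lt2)/implyP.
Qed.

Lemma encode_gt0 v : 0 < encode v.
Proof.
by apply: prodn_gt0 => r; rewrite expn_gt0; have := reg_prime_gt1 r; lia.
Qed.

Definition encode_rest r v : nat := \prod_(i < reg_count | i != r :> nat) reg_prime i ^ v i.

Lemma encodeE r v : r < reg_count -> encode v = reg_prime r ^ v r * encode_rest r v.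
Proof. by move=> lt_r; rewrite /encode (bigD1 (Ordinal lt_r)). Qed.

Lemma encode_upd r v n : r < reg_count ->
  encode (upd v r n) = reg_prime r ^ n * encode_rest r v.
Proof.
move=> lt_r; rewrite (encodeE _ lt_r) /upd eqxx; congr (_ * _).
by apply: eq_bigr => i /negPf ->.
Qed.

Lemma dvdn_encode r v : r < reg_count -> (reg_prime r %| encode v) = (0 < v r).
Proof.
move=> lt_r; rewrite (encodeE _ lt_r).
have co : coprime (reg_prime r) (encode_rest r v).
  rewrite /encode_rest; elim/big_rec: _ => [|i x ne IH]; first exact: coprimen1.
  by rewrite coprimeMr IH coprimeXr // reg_prime_coprime // eq_sym.
rewrite Gauss_dvdl //; case: (v r) => [|n]; last by rewrite dvdn_exp.
by rewrite dvdn1; have := reg_prime_gt1 r; lia.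
Qed.

Definition op_regs (o : op) : bool :=
  match o with Nop => true | Incr r | Decr r | Test r => r < reg_count end.

Fixpoint prog_regs (c : prog) : bool :=
  match c with
  | Skip => true
  | Inc r => r < reg_count
  | Seq a b => prog_regs a && prog_regs b
  | Loop r a => (r < reg_count) && prog_regs a
  | If r a b => [&& r < reg_count, prog_regs a & prog_regs b]
  end.

Lemma compile_regs c p q n e : prog_regs c -> e \in compile c p q n -> op_regs e.1.2.
Proof.
elim: c p q n => [|r|a IHa b IHb|r a IHa|r a IHa b IHb] p q n /=.
- by move=> _; rewrite inE => /eqP ->.
- by move=> lt_r; rewrite inE => /eqP ->.
- by case/andP=> Ha Hb; rewrite mem_cat => /orP[/IHa|/IHb] ->.
- by case/andP=> lt_r Ha; rewrite !inE => /or3P[/eqP ->|/eqP ->|/IHa ->].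
case/and3P=> lt_r Ha Hb; rewrite !inE mem_cat.
by case/or4P=> [/eqP ->|/eqP ->|/IHa ->|/IHb ->].
Qed.

Lemma compile_labels c p q n s o t : (s, o, t) \in compile c p q n ->
  t = p \/ t = q \/ n <= t < n + labels c.
Proof.
elim: c p q n => [|r|a IHa b IHb|r a IHa|r a IHa b IHb] p q n /=.
- by rewrite !inE => /eqP[_ _ ->]; right; left.
- by rewrite !inE => /eqP[_ _ ->]; right; left.
- by rewrite mem_cat => /orP[/IHa|/IHb] []; lia.
- by rewrite !inE => /or3P[/eqP[_ _ ->]|/eqP[_ _ ->]|/IHa[]]; lia.
rewrite !inE mem_cat => /or4P[/eqP[_ _ ->]|/eqP[_ _ ->]|/IHa[]|/IHb[]]; lia.
Qed.

Section Affine.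
Variable S : nat.

Lemma label_split x y p q : p < S -> q < S -> S * x + p = S * y + q -> x = y /\ p = q.
Proof.
move=> lt_p lt_q Exy; have Ex : x = y.
  have := congr1 (divn^~ S) Exy; rewrite !(mulnC S) !divnMDl ?divn_small ?addn0 //; lia.
by split=> //; subst y; lia.
Qed.

(** Codes of configurations are even, so that odd numbers are free for inputs. *)
Definition config_code (p : nat) (v : nat -> nat) : nat := 2 * (S * encode v + p).

(** A test for zero is one rule for each nonzero residue modulo the prime. *)
Definition edge_rules (e : edge) : seq rule :=
  let: (p, o, q) := e in
  match o with
  | Nop => [:: (2 * S, 2 * p, 2 * S, 2 * q)]
  | Incr r => [:: (2 * S, 2 * p, 2 * (S * reg_prime r), 2 * q)]
  | Decr r => [:: (2 * (S * reg_prime r), 2 * p, 2 * S, 2 * q)]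
  | Test r => [seq (2 * (S * reg_prime r), 2 * (S * j + p),
                    2 * (S * reg_prime r), 2 * (S * j + q)) | j <- iota 1 (reg_prime r).-1]
  end.

Lemma edge_rules_complete p o q v w : op_regs o -> op_sem o v w ->
  exists a b c d k, [/\ (a, b, c, d) \in edge_rules (p, o, q),
    config_code p v = a * k + b & config_code q w = c * k + d].
Proof.
rewrite /config_code; case: o => [|r|r|r] /= lt_r.
- move=> ->; exists (2 * S), (2 * p), (2 * S), (2 * q), (encode v).
  by split; [rewrite inE|lia|lia].
- move=> ->; exists (2 * S), (2 * p), (2 * (S * reg_prime r)), (2 * q), (encode v).
  split; [by rewrite inE|lia|].
  by rewrite (encode_upd _ _ lt_r) (encodeE v lt_r) expnS; lia.
- case=> n vn ->; exists (2 * (S * reg_prime r)), (2 * p), (2 * S), (2 * q).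
  exists (encode (upd v r n)).
  split; [by rewrite inE| |lia].
  by rewrite (encode_upd _ _ lt_r) (encodeE v lt_r) vn expnS; lia.
case=> v0 ->; have := dvdn_encode v lt_r; rewrite v0 => /negbT; rewrite /dvdn => nz.
have E := divn_eq (encode v) (reg_prime r).
have lt_m : encode v %% reg_prime r < reg_prime r.
  by rewrite ltn_mod; have := reg_prime_gt1 r; lia.
set j := encode v %% _ in nz E lt_m.
exists (2 * (S * reg_prime r)), (2 * (S * j + p)), (2 * (S * reg_prime r)).
exists (2 * (S * j + q)), (encode v %/ reg_prime r); split.
- by apply/mapP; exists j; rewrite // mem_iota; lia.
- by rewrite {1}E; lia.
by rewrite {1}E; lia.
Qed.

Lemma edge_rules_sound p p' o q v a b c d k : op_regs o -> p < S -> p' < S ->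
  (a, b, c, d) \in edge_rules (p', o, q) -> config_code p v = a * k + b ->
  p = p' /\ exists2 w, op_sem o v w & c * k + d = config_code q w.
Proof.
move=> lt_r lt_p lt_p'.
have split_eq x y := @label_split x y p p' lt_p lt_p'.
rewrite /config_code; case: o lt_r => [|r|r|r] /= lt_r.
- rewrite inE => /eqP[-> -> -> ->] E.
  have [Ek ->] := split_eq (encode v) k ltac:(lia).
  by split=> //; exists v => //; rewrite Ek; lia.
- rewrite inE => /eqP[-> -> -> ->] E.
  have [Ek ->] := split_eq (encode v) k ltac:(lia).
  split=> //; exists (upd v r (v r).+1) => //.
  by rewrite (encode_upd _ _ lt_r) -Ek (encodeE v lt_r) expnS; lia.
- rewrite inE => /eqP[-> -> -> ->] E.
  have [Ek ->] := split_eq (encode v) (reg_prime r * k) ltac:(lia).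
  split=> //; have : reg_prime r %| encode v by rewrite Ek dvdn_mulr.
  rewrite (dvdn_encode v lt_r); case vr: (v r) => [//|n] _.
  exists (upd v r n); first by exists n.
  suff -> : k = encode (upd v r n) by lia.
  rewrite (encode_upd _ _ lt_r); move: Ek; rewrite (encodeE v lt_r) vr expnS -mulnA.
  by move/eqP; rewrite eqn_pmul2l; [move/eqP | have := reg_prime_gt1 r; lia].
case/mapP=> j; rewrite mem_iota => lt_j [-> -> -> ->] E.
have [Ek ->] := split_eq (encode v) (reg_prime r * k + j) ltac:(lia).
split=> //; exists v; last by rewrite Ek; lia.
split=> //; apply/eqP; rewrite -leqn0 leqNgt -(dvdn_encode v lt_r) Ek.
by rewrite dvdn_addr ?dvdn_mulr // gtnNdvd //; lia.
Qed.

End Affine.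

Section Machine.
Variable c : prog.
Hypothesis c_regs : prog_regs c.

Let E := compile c 1 0 2.
Definition label_bound : nat := 2 + labels c.
Let S := label_bound.

(** The first rule starts the machine: it applies to odd numbers only, and to
    2 k + 1 with k = encode v.  The second one sends every configuration at the exit
    label 0 to the number 0. *)
Definition machine_rules : seq rule :=
  (2, 1, 2 * S, 2) :: (2 * S, 0, 0, 0) :: flatten [seq edge_rules S e | e <- E].

Lemma machine_rulesP v :
  affine_reach machine_rules (2 * encode v).+1 0 <-> exists w, exec c v w.
Proof.
have S_gt0 : 0 < S by [].
have bound p o q : (p, o, q) \in E -> p < S /\ q < S.
  move=> Hin; split; first by case/compile_source: Hin; rewrite /S /label_bound; lia.
  by case/compile_labels: Hin; rewrite /S /label_bound; lia.
rewrite halts_flow -/E; split=> [H|[k [w H]]]; last first.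
  have go k' s t : flow E k' s t -> s.1 < S ->
      forall n, affine_reach machine_rules n (config_code S s.1 s.2) ->
      affine_reach machine_rules n (config_code S t.1 t.2).
    elim=> // k1 p o q v' w' t' pq vw _ IH lt_p n Hn.
    have [_ lt_q] := bound _ _ _ pq.
    apply: IH => //; apply: affine_next Hn _.
    have [a [b [e [d [j [Hin E1 E2]]]]]] :=
      edge_rules_complete S p q (compile_regs c_regs pq) vw.
    exists a, b, e, d, j; split=> //; rewrite !inE; apply/orP; right; apply/orP; right.
    by apply/flatten_mapP; exists (p, o, q).
  apply: (@affine_next _ _ (config_code S 0 w)).
    apply: go H _ _ _ => //; apply: affine_next (affine_refl _ _) _.
    exists 2, 1, (2 * S), 2, (encode v); rewrite inE eqxx; split=> //; rewrite /config_code /=; lia.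
  exists (2 * S), 0, 0, 0, (encode w); rewrite !inE eqxx orbT; split=> //.
  by rewrite /config_code /=; lia.
(* Besides the input and 0, only codes of reachable configurations occur. *)
have inv m : affine_reach machine_rules (2 * encode v).+1 m ->
    [\/ m = (2 * encode v).+1,
        exists p w k, [/\ p < S, m = config_code S p w & flow E k (1, v) (p, w)]
      | m = 0 /\ exists k w, flow E k (1, v) (0, w)].
  elim=> [|m' n _ IH [a [b [e [d [j [Hin E1 E2]]]]]]]; first by constructor 1.
  have edge_of : (a, b, e, d) \in flatten [seq edge_rules S x | x <- E] ->
      exists p o q, (p, o, q) \in E /\ (a, b, e, d) \in edge_rules S (p, o, q).
    by case/flatten_mapP=> -[[p o] q]; exists p, o, q.
  have even_of p o q : (a, b, e, d) \in edge_rules S (p, o, q) ->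
      exists a' b', [/\ a = 2 * a', b = 2 * b' & (0 < p -> 0 < b')].
    case: o => [|r|r|r] /=; rewrite ?inE.
    - by case/eqP=> -> -> _ _; exists S, p.
    - by case/eqP=> -> -> _ _; exists S, p.
    - by case/eqP=> -> -> _ _; exists (S * reg_prime r), p.
    case/mapP=> i _ [-> -> _ _]; exists (S * reg_prime r), (S * i + p).
    by split=> //; lia.
  move: Hin; rewrite !inE => /or3P[/eqP[? ? ? ?]|/eqP[? ? ? ?]|]; subst.
  - case: IH => [Ev|[p [w [k [_ Em _]]]]|[]]; [|rewrite /config_code in Em; lia|lia].
    have -> : j = encode v by lia.
    constructor 2; exists 1, v, 0; split; [by []| rewrite /config_code; lia | exact: flow0].
  - case: IH => [|[p [w [k [lt_p Em Hk]]]]|[]]; [lia| |].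
      constructor 3; split; first by lia.
      have [//|_ p0] := @label_split S (encode w) j p 0 lt_p S_gt0.
        by rewrite /config_code in Em; lia.
      by subst p; exists k, w.
    by move=> _ Hk; constructor 3; split=> //; lia.
  case/edge_of=> p [o [q [Hpq Hr]]].
  have [a' [b' [Ea Eb b'_gt0]]] := even_of _ _ _ Hr.
  have p_gt0 : 0 < p by case/compile_source: Hpq; lia.
  case: IH => [|[p' [w [k [lt_p Em Hk]]]]|[]]; [lia| |by have := b'_gt0 p_gt0; nia].
  have [lt_p' lt_q] := bound _ _ _ Hpq.
  have := edge_rules_sound (compile_regs c_regs Hpq) lt_p lt_p' Hr.
  move=> /(_ _ _ (esym Em)) [Ep [w' Hw' Ew']]; subst p'.
  constructor 2; exists q, w', (k + 1); split=> //.
  by apply: flow_trans Hk _; apply: flowS Hpq Hw' (flow0 _ _).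
case: (inv 0 H) => [//|[p [w [k [_ E0 _]]]]|[_ //]].
by have := encode_gt0 w; rewrite /config_code in E0; nia.
Qed.

End Machine.

(** * Programs on explicit stores *)

Notation "a ;; b" := (Seq a b) (at level 61, right associativity).

Definition store (l : seq nat) : nat -> nat := nth 0 l.

Lemma upd_store l r n : upd (store l) r n = store (set_nth 0 l r n).
Proof.
by apply: functional_extensionality => i; rewrite /store nth_set_nth.
Qed.

Lemma exec_incr r l : exec (Inc r) (store l) (store (set_nth 0 l r (nth 0 l r).+1)).
Proof. by rewrite -upd_store; apply: exec_inc. Qed.

(** l k is the store after k rounds. *)
Lemma exec_for r a (l : nat -> seq nat) n :
  (forall k, k <= n -> nth 0 (l k) r = n - k) ->
  (forall k, k < n -> exec a (store (set_nth 0 (l k) r (n - k).-1)) (store (l k.+1))) ->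
  exec (Loop r a) (store (l 0)) (store (l n)).
Proof.
elim: n l => [|n IH] l Hr Ha; first by apply: exec_loop0; rewrite /store Hr.
apply: (exec_loopS (n := n)); first by rewrite /store Hr.
  by rewrite upd_store; exact: Ha.
apply: (IH (fun k => l k.+1)) => k lt_k; first by rewrite Hr.
exact: Ha.
Qed.

(** The registers: rB + 1 is the base in which strings are coded, rT the transition
    table, rQ the state, rR and rL the two halves of the tape; rW is the number
    that pop and push act on and rD the digit they exchange with it; rF is a flag,
    rN an input code or a saved digit, rX and rY are scratch registers. *)
Notation rB := 0 (only parsing).
Notation rT := 1 (only parsing).
Notation rQ := 2 (only parsing).
Notation rR := 3 (only parsing).
Notation rL := 4 (only parsing).
Notation rW := 5 (only parsing).
Notation rD := 6 (only parsing).
Notation rF := 7 (only parsing).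
Notation rN := 8 (only parsing).
Notation rX := 9 (only parsing).
Notation rY := 10 (only parsing).

Definition transfer X Y : prog := Loop X (Inc Y).
Definition clear X : prog := Loop X Skip.
Definition incs m r : prog := iter m (Seq (Inc r)) Skip.

Lemma exec_transfer X Y l : X != Y -> exec (transfer X Y) (store l)
  (store (set_nth 0 (set_nth 0 l Y (nth 0 l Y + nth 0 l X)) X 0)).
Proof.
move=> neXY; rewrite /transfer; set n := nth 0 l X.
pose f k := set_nth 0 (set_nth 0 l Y (nth 0 l Y + k)) X (n - k).
have stE l1 l2 : nth 0 l1 =1 nth 0 l2 -> store l1 = store l2.
  exact: functional_extensionality.
have -> : store l = store (f 0).
  apply: stE => i; rewrite /f !nth_set_nth /= subn0 nth_set_nth /= addn0.
  by case: eqP => [->|] //; case: eqP => [->|].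
have := @exec_for X (Inc Y) f n; rewrite {5}/f subnn; apply=> k lt_k.
  by rewrite /f nth_set_nth /= eqxx.
rewrite -upd_store; set v := upd _ _ _; have -> : store (f k.+1) = upd v Y (v Y).+1.
  apply: functional_extensionality => i; rewrite /v /upd /f /store !nth_set_nth /=.
  rewrite !nth_set_nth /= eqxx [Y == X]eq_sym (negPf neXY) addnS.
  have [->|neY] := eqVneq i Y; first by rewrite eq_sym (negPf neXY).
  by case: eqP => // _; lia.
exact: exec_inc.
Qed.

Lemma exec_clear X l : exec (clear X) (store l) (store (set_nth 0 l X 0)).
Proof.
rewrite /clear; set n := nth 0 l X.
pose f k := set_nth 0 l X (n - k).
have -> : store l = store (f 0).
  apply: functional_extensionality => i; rewrite /store /f nth_set_nth /= subn0.
  by case: eqP => [->|].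
have := @exec_for X Skip f n; rewrite {5}/f subnn; apply=> k lt_k.
  by rewrite /f nth_set_nth /= eqxx.
have -> : store (f k.+1) = store (set_nth 0 (f k) X (n - k).-1).
  apply: functional_extensionality => i; rewrite /store /f !nth_set_nth /=.
  by rewrite nth_set_nth /=; case: eqP => // _; lia.
exact: exec_skip.
Qed.

Lemma exec_incs m r l : exec (incs m r) (store l) (store (set_nth 0 l r (nth 0 l r + m))).
Proof.
elim: m l => [|m IH] l /=.
  rewrite addn0 -upd_store.
  have -> : upd (store l) r (nth 0 l r) = store l.
    by apply: functional_extensionality => i; rewrite /upd; case: eqP => [->|].
  exact: exec_skip.
apply: exec_seq; first exact: exec_incr.
have := IH (set_nth 0 l r (nth 0 l r).+1).
by rewrite nth_set_nth /= eqxx set_set_nth eqxx addSnnS.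
Qed.

Ltac run_step lem := apply: exec_seq; [by apply: lem | rewrite /= ?add0n ?addn0].

(** rD and rY share the value of rB during the main loop.  When rY is exhausted, rD
    has reached the base minus 1, and the next unit completes a quotient. *)
Definition pop : prog :=
  transfer rB rY ;; Loop rW (If rY (Inc rD) (transfer rD rY ;; Inc rX)) ;;
  transfer rX rW ;;
  transfer rY rB ;; Loop rD (Inc rB ;; Inc rY) ;; transfer rY rD.

Lemma exec_pop b T q R L W A N :
  exec pop (store [:: b; T; q; R; L; W; 0; A; N; 0; 0])
           (store [:: b; T; q; R; L; W %/ b.+1; W %% b.+1; A; N; 0; 0]).
Proof.
rewrite /pop; run_step exec_transfer.
apply: exec_seq.
  have := @exec_for rW (If rY (Inc rD) (transfer rD rY ;; Inc rX))
    (fun k => [:: 0; T; q; R; L; W - k; k %% b.+1; A; N; k %/ b.+1; b - k %% b.+1]) W.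
  rewrite mod0n div0n !subn0 subnn; apply=> // k lt_k /=.
  have lt_m : k %% b.+1 < b.+1 by rewrite ltn_mod.
  have Ek := divn_eq k b.+1.
  have [lt_b|ge_b] := ltnP (k %% b.+1) b.
    apply: (@exec_ifS _ _ _ (b - k %% b.+1).-1); first by rewrite /store /=; lia.
    have [-> ->] : k.+1 %/ b.+1 = k %/ b.+1 /\ k.+1 %% b.+1 = (k %% b.+1).+1.
      have -> : k.+1 = k %/ b.+1 * b.+1 + (k %% b.+1).+1 by lia.
      by rewrite divnMDl // [_.+1 %/ _]divn_small // addn0 modnMDl [_.+1 %% _]modn_small.
    rewrite upd_store /= -!subnS.
    by have := exec_incr rD [:: 0; T; q; R; L; W - k.+1; k %% b.+1; A; N; k %/ b.+1;
      b - (k %% b.+1).+1].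
  have eb : k %% b.+1 = b by lia.
  apply: exec_if0; first by rewrite /store /=; lia.
  have [-> ->] : k.+1 %/ b.+1 = (k %/ b.+1).+1 /\ k.+1 %% b.+1 = 0.
    have -> : k.+1 = (k %/ b.+1).+1 * b.+1 by rewrite mulSn; lia.
    by rewrite mulnK // modnMl.
  rewrite eb subnn -subnS; run_step exec_transfer.
  by rewrite subn0; apply: exec_incr.
rewrite /=; run_step exec_transfer; run_step exec_transfer.
apply: exec_seq.
  have := @exec_for rD (Inc rB ;; Inc rY)
    (fun k => [:: b - W %% b.+1 + k; T; q; R; L; W %/ b.+1; W %% b.+1 - k; A; N; 0; k])
    (W %% b.+1).
  rewrite subnn subn0 addn0; apply=> // k lt_k /=.
  run_step exec_incr; rewrite addnS -subnS; exact: exec_incr.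
rewrite /=; have := @exec_transfer rY rD
  [:: b - W %% b.+1 + W %% b.+1; T; q; R; L; W %/ b.+1; 0; A; N; 0; W %% b.+1].
rewrite /= add0n subnK; first by apply.
by rewrite -ltnS ltn_mod.
Qed.

Definition push : prog :=
  Loop rW (Inc rX ;; Loop rB (Inc rX ;; Inc rY) ;; transfer rY rB) ;;
  transfer rX rW ;; transfer rD rW.

Lemma exec_push b T q R L W D A N :
  exec push (store [:: b; T; q; R; L; W; D; A; N; 0; 0])
            (store [:: b; T; q; R; L; W * b.+1 + D; 0; A; N; 0; 0]).
Proof.
rewrite /push; apply: exec_seq.
  have := @exec_for rW (Inc rX ;; Loop rB (Inc rX ;; Inc rY) ;; transfer rY rB)
    (fun k => [:: b; T; q; R; L; W - k; D; A; N; k * b.+1; 0]) W.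
  rewrite subnn subn0; apply=> // k lt_k /=.
  run_step exec_incr; apply: exec_seq.
    have := @exec_for rB (Inc rX ;; Inc rY)
      (fun j => [:: b - j; T; q; R; L; (W - k).-1; D; A; N; (k * b.+1 + j).+1; j]) b.
    rewrite subnn subn0 addn0; apply=> // j lt_j /=.
    run_step exec_incr; rewrite addnS -subnS; exact: exec_incr.
  have := @exec_transfer rY rB
    [:: 0; T; q; R; L; (W - k).-1; D; A; N; (k * b.+1 + b).+1; b].
  by rewrite /= add0n -subnS mulSnr addnS; apply.
rewrite /=; run_step exec_transfer; exact: exec_transfer.
Qed.

(** * The universal simulator *)

Definition scale m : prog := Loop rN (incs m rX) ;; transfer rX rN.

Lemma exec_scale m b T q R L W D A N u :
  exec (scale m) (store [:: b; T; q; R; L; W; D; A; N; 0; u])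
                 (store [:: b; T; q; R; L; W; D; A; N * m; 0; u]).
Proof.
rewrite /scale; apply: exec_seq.
  have := @exec_for rN (incs m rX)
    (fun k => [:: b; T; q; R; L; W; D; A; N - k; k * m; u]) N.
  rewrite subnn subn0; apply=> // k lt_k /=.
  by rewrite -subnS mulSnr; apply: exec_incs.
have := @exec_transfer rX rN [:: b; T; q; R; L; W; D; A; 0; N * m; u].
by rewrite /= add0n; apply.
Qed.

(** The number that codes the input registers of the simulator for its own affine
    rules, cf. machine_rulesP and encode_input. *)
Definition input_code (b T q : nat) : nat := (2 * (2 ^ b * 3 ^ T * 5 ^ q)).+1.

Definition compute_code : prog :=
  Inc rN ;; Loop rB (Inc rY ;; scale 2) ;; transfer rY rB ;;
  Loop rT (Inc rY ;; scale 3) ;; transfer rY rT ;;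
  Loop rQ (Inc rY ;; scale 5) ;; transfer rY rQ ;; scale 2 ;; Inc rN.

Lemma exec_compute_code b T q :
  exec compute_code (store [:: b; T; q; 0; 0; 0; 0; 0; 0; 0; 0])
    (store [:: b; T; q; 0; 0; 0; 0; 0; input_code b T q; 0; 0]).
Proof.
rewrite /compute_code; run_step exec_incr; apply: exec_seq.
  have := @exec_for rB (Inc rY ;; scale 2)
    (fun k => [:: b - k; T; q; 0; 0; 0; 0; 0; 2 ^ k; 0; k]) b.
  rewrite subnn subn0 expn0; apply=> // k lt_k /=.
  run_step exec_incr; rewrite -subnS expnSr; exact: exec_scale.
rewrite /=; run_step exec_transfer; apply: exec_seq.
  have := @exec_for rT (Inc rY ;; scale 3)
    (fun k => [:: b; T - k; q; 0; 0; 0; 0; 0; 2 ^ b * 3 ^ k; 0; k]) T.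
  rewrite subnn subn0 expn0 muln1; apply=> // k lt_k /=.
  run_step exec_incr; rewrite -subnS expnSr mulnA; exact: exec_scale.
rewrite /=; run_step exec_transfer; apply: exec_seq.
  have := @exec_for rQ (Inc rY ;; scale 5)
    (fun k => [:: b; T; q - k; 0; 0; 0; 0; 0; 2 ^ b * 3 ^ T * 5 ^ k; 0; k]) q.
  rewrite subnn subn0 expn0 muln1; apply=> // k lt_k /=.
  run_step exec_incr; rewrite -subnS expnSr mulnA; exact: exec_scale.
rewrite /=; run_step exec_transfer; run_step exec_scale.
rewrite /input_code [2 * _]mulnC; exact: exec_incr.
Qed.

(** The digit 0 is left for the blank. *)
Definition digit (a : 'I_2 * bool) : nat := (index a (enum {: 'I_2 * bool})).+1.

Definition shift_in (b : nat) (w : seq ('I_2 * bool)) (W : nat) : nat :=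
  foldr (fun a n => n * b.+1 + digit a) W w.

Lemma shift_in_cat b w1 w2 W :
  shift_in b (w1 ++ w2) W = shift_in b w1 (shift_in b w2 W).
Proof. exact: foldr_cat. Qed.

Arguments digit : simpl never.
Arguments shift_in : simpl never.

(** The last letter is pushed first, so that the first letter becomes the lowest
    digit, which is the cell under the head. *)
Definition push_word (w : seq ('I_2 * bool)) : prog :=
  foldr (fun a P => P ;; incs (digit a) rD ;; push) Skip w.

Arguments push_word : simpl never.

Lemma exec_push_word w b T q R L W A N :
  exec (push_word w) (store [:: b; T; q; R; L; W; 0; A; N; 0; 0])
                     (store [:: b; T; q; R; L; shift_in b w W; 0; A; N; 0; 0]).
Proof.
elim: w => [|a w IH]; first exact: exec_skip.
apply: exec_seq IH _; apply: exec_seq; first exact: (@exec_incs (digit a)).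
exact: (@exec_push _ _ _ _ _ _ (digit a)).
Qed.

(** The powers x^(3N) and x^(-3N) need one loop each; the first loop saves
    the loop counter in rF. *)
Definition write_input : prog :=
  push_word word_post ;;
  Loop rN (Inc rF ;; push_word (nseq 3 (lx false))) ;; transfer rF rN ;;
  push_word word_mid ;;
  Loop rN (push_word (nseq 3 (lx true))) ;;
  push_word word_pre ;; transfer rW rR.

Lemma shift_in_nseq b a W k :
  shift_in b (nseq 3 a) (shift_in b (nseq (3 * k) a) W)
  = shift_in b (nseq (3 * k.+1) a) W.
Proof. by rewrite -shift_in_cat cat_nseq mulnS. Qed.

Lemma exec_write_input b T q N :
  exec write_input (store [:: b; T; q; 0; 0; 0; 0; 0; N; 0; 0])
    (store [:: b; T; q; shift_in b (target_word N) 0; 0; 0; 0; 0; 0; 0; 0]).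
Proof.
rewrite /write_input /target_word !shift_in_cat; run_step exec_push_word.
set W1 := shift_in b word_post 0; apply: exec_seq.
  have := @exec_for rN (Inc rF ;; push_word (nseq 3 (lx false)))
    (fun k => [:: b; T; q; 0; 0; shift_in b (nseq (3 * k) (lx false)) W1; 0; k; N - k; 0; 0]) N.
  rewrite subnn subn0; apply=> // k lt_k.
  rewrite -shift_in_nseq -subnS; apply: exec_seq; first exact: exec_incr.
  exact: exec_push_word.
rewrite /=; run_step exec_transfer; run_step exec_push_word.
set W2 := shift_in b word_mid _; apply: exec_seq.
  have := @exec_for rN (push_word (nseq 3 (lx true)))
    (fun k => [:: b; T; q; 0; 0; shift_in b (nseq (3 * k) (lx true)) W2; 0; 0; N - k; 0; 0]) N.
  rewrite subnn subn0; apply=> // k lt_k.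
  rewrite -shift_in_nseq -subnS; exact: exec_push_word.
rewrite /=; run_step exec_push_word; exact: exec_transfer.
Qed.

(** The index of the table entry is state * base + symbol.  An entry has three
    digits: direction, new symbol, new state; the loop on rQ drops the entries
    in front of it.  After the new symbol is written, moving the head pops a
    symbol from one half of the tape and pushes it onto the other. *)
Definition step_body : prog :=
  transfer rR rW ;; pop ;; transfer rW rR ;;
  transfer rQ rW ;; push ;; transfer rW rQ ;;
  Loop rT (Inc rW ;; Inc rX) ;; transfer rX rT ;;
  Loop rQ (pop ;; clear rD ;; pop ;; clear rD ;; pop ;; clear rD) ;;
  pop ;; transfer rD rF ;; pop ;; transfer rD rN ;; pop ;; transfer rD rQ ;;
  clear rW ;; transfer rR rW ;; transfer rN rD ;; push ;;
  If rF
    (pop ;; transfer rW rR ;; transfer rL rW ;; push ;; transfer rW rL ;; clear rF)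
    (transfer rW rR ;; transfer rL rW ;; pop ;; transfer rW rL ;;
     transfer rR rW ;; push ;; transfer rW rR).

Definition step_nat (b T : nat) (s : nat * nat * nat) : nat * nat * nat :=
  let: (q, L, R) := s in
  let W := T %/ (b.+1 ^ 3) ^ (q * b.+1 + R %% b.+1) in
  let q' := W %/ b.+1 %/ b.+1 %% b.+1 in
  let R' := R %/ b.+1 * b.+1 + W %/ b.+1 %% b.+1 in
  if 0 < W %% b.+1 then (q', L * b.+1 + R' %% b.+1, R' %/ b.+1)
  else (q', L %/ b.+1, R' * b.+1 + L %% b.+1).

Definition main_state (b T : nat) (s : nat * nat * nat) : nat -> nat :=
  let: (q, L, R) := s in store [:: b; T; q; R; L; 0; 0; 0; 0; 0; 0].

Lemma exec_step_body b T s :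
  exec step_body (main_state b T s) (main_state b T (step_nat b T s)).
Proof.
case: s => [[q L] R]; rewrite /step_body /main_state.
run_step exec_transfer; run_step exec_pop; run_step exec_transfer;
run_step exec_transfer; run_step exec_push.
run_step exec_transfer; apply: exec_seq.
  have := @exec_for rT (Inc rW ;; Inc rX) (fun k => [:: b; T - k; q * b.+1 + R %% b.+1;
    R %/ b.+1; L; k; 0; 0; 0; k; 0]) T.
  rewrite subnn subn0; apply=> // k lt_k /=.
  run_step exec_incr; rewrite -subnS; exact: exec_incr.
rewrite /=; run_step exec_transfer; rewrite /step_nat.
set j := q * b.+1 + _; apply: exec_seq.
  have := @exec_for rQ (pop ;; clear rD ;; pop ;; clear rD ;; pop ;; clear rD)
    (fun k => [:: b; T; j - k; R %/ b.+1; L; T %/ (b.+1 ^ 3) ^ k; 0; 0; 0; 0; 0]) j.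
  rewrite subnn subn0 expn0 divn1; apply=> // k lt_k /=.
  run_step exec_pop; run_step exec_clear; run_step exec_pop; run_step exec_clear;
  run_step exec_pop.
  have -> : T %/ (b.+1 ^ 3) ^ k.+1 = T %/ (b.+1 ^ 3) ^ k %/ b.+1 %/ b.+1 %/ b.+1.
    by rewrite -!divnMA expnSr !expnS expn0 muln1 !mulnA.
  rewrite -subnS; exact: exec_clear.
rewrite /=; set W := T %/ _.
run_step exec_pop; run_step exec_transfer; run_step exec_pop; run_step exec_transfer;
run_step exec_pop.
run_step exec_transfer; run_step exec_clear; run_step exec_transfer;
run_step exec_transfer; run_step exec_push.
set R' := R %/ _ * _ + _; set q' := W %/ _ %/ _ %% _.
case d: (W %% b.+1) => [|n].
  apply: exec_if0; first by [].
  run_step exec_transfer; run_step exec_transfer; run_step exec_pop;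
  run_step exec_transfer; run_step exec_transfer.
  run_step exec_push; exact: exec_transfer.
apply: (@exec_ifS _ _ _ n); first by [].
rewrite upd_store /=; run_step exec_pop; run_step exec_transfer; run_step exec_transfer;
run_step exec_push.
run_step exec_transfer; exact: exec_clear.
Qed.

Definition simulator : prog :=
  compute_code ;; write_input ;; Loop rQ (Inc rQ ;; step_body).

Lemma exec_main_loop b T s :
  (exists w, exec (Loop rQ (Inc rQ ;; step_body)) (main_state b T s) w) <->
  exists n, (iter n (step_nat b T) s).1.1 = 0.
Proof.
have q_st s' : main_state b T s' rQ = s'.1.1 by case: s' => [[]].
have body s' n : s'.1.1 = n.+1 -> exec (Inc rQ ;; step_body)
    (upd (main_state b T s') rQ n) (main_state b T (step_nat b T s')).
  case: s' => [[q L] R] /= ->; rewrite upd_store /=; apply: exec_seq.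
    exact: exec_incr.
  exact: (@exec_step_body b T (n.+1, L, R)).
split=> [[w]|[n]]; last first.
  elim: n s => [|n IH] s Hs; first by exists (main_state b T s); apply: exec_loop0; rewrite q_st.
  case q_s: (s.1.1) => [|q].
    by exists (main_state b T s); apply: exec_loop0; rewrite q_st.
  move: Hs; rewrite iterSr => /IH [w Hw]; exists w.
  by apply: (exec_loopS (n := q)) (body _ _ q_s) Hw; rewrite q_st.
move E: (Loop _ _) => p; move Ev: (main_state _ _ _) => v H.
elim: H s E Ev => // [r a v0 v0r|r a n v0 v1 v2 vn Ha _ _ IH] s [Er Ea] Ev; subst.
  by exists 0; rewrite /= -q_st.
rewrite q_st in vn; have Ev1 := exec_det (body _ _ vn) Ha.
have [k Hk] := IH (step_nat b T s) erefl Ev1.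
by exists k.+1; rewrite iterSr.
Qed.

(** The simulated tape starts with the word that spells the target for the code of
    the input that the simulator is run on. *)
Lemma simulatorP b T q :
  (exists w, exec simulator (store [:: b; T; q; 0; 0; 0; 0; 0; 0; 0; 0]) w) <->
  exists n, (iter n (step_nat b T)
    (q, 0, shift_in b (target_word (input_code b T q)) 0)).1.1 = 0.
Proof.
rewrite -exec_main_loop /simulator.
have H1 := exec_compute_code b T q.
have H2 := exec_write_input b T q (input_code b T q).
split=> [[w H]|[w H]]; exists w; last by apply: exec_seq H1 (exec_seq H2 H).
inversion H as [| |? ? ? v1 ? Ha Hb| | | |]; subst.
inversion Hb as [| |? ? ? v2 ? Hc Hd| | | |]; subst.
have E1 := exec_det H1 Ha; subst v1.
by have E2 := exec_det H2 Hc; subst v2.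
Qed.

Lemma prog_regs_push_word w : prog_regs (push_word w).
Proof.
have I m r : r < reg_count -> prog_regs (incs m r).
  by move=> lt_r; elim: m => //= m ->; rewrite lt_r.
by elim: w => // a w IH; rewrite [prog_regs _]/= IH I.
Qed.

Lemma prog_regs_simulator : prog_regs simulator.
Proof.
have write_ok : prog_regs write_input.
  by rewrite /write_input; move: push_word prog_regs_push_word => pw pwE; rewrite /= !pwE.
by rewrite /simulator; move: write_input write_ok => p p_ok; rewrite /= p_ok.
Qed.

Lemma encode_input b T q :
  encode (store [:: b; T; q; 0; 0; 0; 0; 0; 0; 0; 0]) = 2 ^ b * 3 ^ T * 5 ^ q.
Proof.
by rewrite /encode /reg_count /store !big_ord_recl big_ord0 /= !expn0 !muln1 !mulnA.
Qed.

(** * Turing machines as numbers *)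

Section Digits.
Variables (C : nat) (f : nat -> nat).
Hypotheses (C_gt0 : 0 < C) (f_lt : forall j, f j < C).

Definition number (m n : nat) : nat := foldr (fun j acc => acc * C + f j) 0 (iota m n).

(** The division removes the digits below place j; those above it make up x. *)
Lemma number_digit j n m : j < n ->
  exists x, number m n %/ C ^ j = x * C + f (m + j).
Proof.
elim: j n m => [|j IH] [|n] m //= lt_j; rewrite /number /= -/(number m.+1 n).
  by exists (number m.+1 n); rewrite divn1 addn0.
have [//|x Hx] := IH n m.+1; exists x.
by rewrite expnS divnMA divnMDl // (divn_small (f_lt m)) addn0 Hx addSnnS.
Qed.

End Digits.

Section Simulation.
Variable D : turing_machine ('I_2 * bool)%type.

(** The order makes the code of the blank 0 and the code of an input letter
    independent of D. *)
Definition symbols : seq (tm_symbol D) :=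
  tm_blank D :: map (@tm_input _ D) (enum {: 'I_2 * bool}) ++ enum (tm_symbol D).
(** The rejecting state gets code 0, the value at which the simulator stops. *)
Definition states : seq (tm_state D) := tm_reject D :: enum (tm_state D).

Definition sym_code (s : tm_symbol D) : nat := index s symbols.
Definition state_code (q : tm_state D) : nat := index q states.

Definition base : nat := size symbols + size states.

Lemma sym_code_lt s : sym_code s < base.+1.
Proof. by rewrite ltnS /base (leq_trans (index_size _ _)) // leq_addr. Qed.

Lemma state_code_lt q : state_code q < base.+1.
Proof. by rewrite ltnS /base (leq_trans (index_size _ _)) // leq_addl. Qed.

Lemma sym_codeK s : nth (tm_blank D) symbols (sym_code s) = s.
Proof. by rewrite nth_index // inE mem_cat mem_enum !orbT. Qed.

Lemma state_codeK q : nth (tm_reject D) states (state_code q) = q.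
Proof. by rewrite nth_index // inE mem_enum orbT. Qed.

Lemma sym_code_blank : sym_code (tm_blank D) = 0.
Proof. by rewrite /sym_code /symbols /= eqxx. Qed.

Lemma sym_code_input a : sym_code (@tm_input _ D a) = digit a.
Proof.
rewrite /sym_code /symbols /= eq_sym (negPf (tm_input_blank D a)) /digit; congr _.+1.
rewrite index_cat map_f ?mem_enum // index_map //; exact: tm_input_inj.
Qed.

Lemma state_code_eq0 q : (state_code q == 0) = (q == tm_reject D).
Proof. by rewrite /state_code /states /= [tm_reject D == q]eq_sym; case: (q == _). Qed.

(** The accepting state is made to move on forever, since the simulator is to stop
    upon rejection only. *)
Definition table_move (q : tm_state D) (s : tm_symbol D) :=
  if q == tm_accept D then (tm_accept D, s, true) else tm_step q s.

Definition table_entry (j : nat) : nat :=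
  let: (q, s, r) := table_move (nth (tm_reject D) states (j %/ base.+1))
                                   (nth (tm_blank D) symbols (j %% base.+1)) in
  (state_code q * base.+1 + sym_code s) * base.+1 + r.

Definition table : nat := number (base.+1 ^ 3) table_entry 0 (base.+1 * base.+1).

Lemma table_entry_lt j : table_entry j < base.+1 ^ 3.
Proof.
rewrite /table_entry; case: table_move => [[q s] r].
have := state_code_lt q; have := sym_code_lt s; have r_lt : r < base.+1 by case: r.
by rewrite !expnS expn0 muln1; nia.
Qed.

Lemma table_lookup q x q' s' r : x < base.+1 ->
  table_move q (nth (tm_blank D) symbols x) = (q', s', r) ->
  let W := table %/ (base.+1 ^ 3) ^ (state_code q * base.+1 + x) in
  [/\ W %% base.+1 = r, W %/ base.+1 %% base.+1 = sym_code s' &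
      W %/ base.+1 %/ base.+1 %% base.+1 = state_code q'].
Proof.
move=> lt_s E /=; set j := _ + _.
have lt_q := state_code_lt q.
have lt_j : j < base.+1 * base.+1 by rewrite /j; nia.
have C_gt0 : 0 < base.+1 ^ 3 by rewrite expn_gt0.
have [d Hd] := number_digit C_gt0 table_entry_lt 0 lt_j.
rewrite /table Hd add0n {Hd}.
have -> : table_entry j = (state_code q' * base.+1 + sym_code s') * base.+1 + r.
  rewrite /table_entry /j divnMDl // modnMDl (divn_small lt_s) (modn_small lt_s) addn0.
  by rewrite state_codeK E.
have r_lt : r < base.+1 by case: (r).
have lt_q' := state_code_lt q'; have lt_s' := sym_code_lt s'.
set y := state_code q'; set z := sym_code s'.
have -> : d * base.+1 ^ 3 + ((y * base.+1 + z) * base.+1 + r)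
    = ((d * base.+1 + y) * base.+1 + z) * base.+1 + r by rewrite !expnS expn0; lia.
rewrite modnMDl (modn_small r_lt) divnMDl // (divn_small r_lt) addn0.
rewrite modnMDl (modn_small lt_s') divnMDl // (divn_small lt_s') addn0.
by rewrite modnMDl (modn_small lt_q').
Qed.

Definition tape_code (l : seq (tm_symbol D)) : nat :=
  foldr (fun s n => n * base.+1 + sym_code s) 0 l.

Lemma tape_code_mod l : tape_code l %% base.+1 = sym_code (head (tm_blank D) l).
Proof.
case: l => [|s l] /=; first by rewrite mod0n sym_code_blank.
by rewrite modnMDl modn_small // sym_code_lt.
Qed.

Lemma tape_code_div l : tape_code l %/ base.+1 = tape_code (behead l).
Proof.
case: l => [|s l] /=; first by rewrite div0n.
by rewrite divnMDl // divn_small ?addn0 // sym_code_lt.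
Qed.

Lemma tape_code_input w : tape_code (map (@tm_input _ D) w) = shift_in base w 0.
Proof. by elim: w => //= a w ->; rewrite sym_code_input. Qed.

(** Once D accepts, its tape stands still while the simulated tape goes on moving. *)
Definition simulates (s : nat * nat * nat) (c : tm_config D) : Prop :=
  s.1.1 = state_code c.1.1 /\
  (c.1.1 != tm_accept D -> s.1.2 = tape_code c.1.2 /\ s.2 = tape_code c.2).

Lemma simulates_step s c : c.1.1 != tm_reject D -> simulates s c ->
  simulates (step_nat base table s) (tm_next c).
Proof.
case: s c => [[x L] R] [[q l] r] /= ne_rej [/= -> H].
case: (eqVneq q (tm_accept D)) => [q_acc|ne_acc] in H *.
  subst q; split; last by rewrite /= eqxx.
  have lt_s : R %% base.+1 < base.+1 by rewrite ltn_mod.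
  have Em : table_move (tm_accept D) (nth (tm_blank D) symbols (R %% base.+1))
      = (tm_accept D, nth (tm_blank D) symbols (R %% base.+1), true).
    by rewrite /table_move eqxx.
  by have [-> _ ->] := table_lookup lt_s Em.
have [-> ->] := H isT.
rewrite (negPf ne_rej) /=.
case E: tm_step => [[q' s'] d]; rewrite /= tape_code_mod.
have Em : table_move q (nth (tm_blank D) symbols (sym_code (head (tm_blank D) r)))
    = (q', s', d).
  by rewrite sym_codeK /table_move (negPf ne_acc).
have [-> -> ->] := table_lookup (sym_code_lt _) Em.
rewrite tape_code_div; case: d {E Em} => /=; split=> //= _.
  rewrite modnMDl divnMDl // (modn_small (sym_code_lt s')).
  by rewrite (divn_small (sym_code_lt s')) addn0.
by rewrite tape_code_mod tape_code_div.
Qed.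

(** Past rejection the simulation loses its meaning, hence the alternative. *)
Lemma simulation w n :
  let s k := iter k (step_nat base table)
    (state_code (tm_start D), 0, shift_in base w 0) in
  (exists k, (s k).1.1 = 0 /\ (iter k (@tm_next _ D) (tm_init D w)).1.1 = tm_reject D) \/
  simulates (s n) (iter n (@tm_next _ D) (tm_init D w)).
Proof.
elim: n => [|n [IH|IH]] /=; [right| by left|].
  by split=> //= _; rewrite tape_code_input.
case: (eqVneq (iter n (@tm_next _ D) (tm_init D w)).1.1 (tm_reject D)) => [E|ne].
  left; exists n; split=> //; case: IH => -> _.
  by apply/eqP; rewrite state_code_eq0 E.
by right; apply: simulates_step.
Qed.

Lemma simulates_reject w :
  (exists n, (iter n (step_nat base table)
     (state_code (tm_start D), 0, shift_in base w 0)).1.1 = 0) <->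
  tm_reaches w (tm_reject D).
Proof.
split=> [[n Hn]|[n Hn]]; case: (simulation w n) => [[k [E1 E2]]|[E _]].
- by exists k.
- by exists n; apply/eqP; rewrite -state_code_eq0 -E Hn.
- by exists k.
by exists n; rewrite E Hn; apply/eqP; rewrite state_code_eq0.
Qed.

Lemma halted_iter (c : tm_config D) k :
  (c.1.1 == tm_accept D) || (c.1.1 == tm_reject D) -> iter k (@tm_next _ D) c = c.
Proof.
case: c => [[q l] r] H; elim: k => // k /= ->; by rewrite /tm_next H.
Qed.

Lemma accept_reject_exclusive w :
  tm_reaches w (tm_accept D) -> tm_reaches w (tm_reject D) -> False.
Proof.
move=> [n Hn] [m Hm]; have /eqP := tm_accept_reject D; apply; rewrite -[LHS]Hn -[RHS]Hm.
case: (leqP n m) => [/subnK <-|/ltnW/subnK <-]; rewrite iterD [iter (_ - _) _ _]halted_iter //.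
  by rewrite Hn eqxx.
by rewrite Hm eqxx orbT.
Qed.

End Simulation.

(** * Undecidability *)

Theorem theorem4p17 :
  exists (X : seq (free_group 'I_2)) (phi : automorphism (free_group 'I_2)),
    membership_undecidable (@fgen 'I_2)
      (submonoid_gen (fun y : free_group 'I_2 =>
         exists (i : int) (x : free_group 'I_2), x \in X /\ y = aut_iter phi i x)).
Proof.
have [phi [phix phiy]] := twist_exists.
pose G := machine_rules simulator.
exists (rule_elts G), phi => -[D HD].
set b := base D; set T := table D; set q := state_code (tm_start D).
pose N := input_code b T q.
(* D is run on the word that spells the target for its own code N. *)
have [acc_or_rej acc_iff] := HD (target_word N).
have member_iff : rule_submonoid G phi (target N) <->
    tm_reaches (target_word N) (tm_reject D).
  rewrite -simulates_reject -simulatorP -machine_rulesP ?prog_regs_simulator //.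
  rewrite encode_input; split; first exact: target_reach.
  exact: reach_target.
rewrite eval_target_word in acc_iff.
case: acc_or_rej => H.
  by apply: accept_reject_exclusive (H) _; apply/member_iff/acc_iff.
by apply: accept_reject_exclusive _ (H); apply/acc_iff/member_iff.
Qed.
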